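(* Let $(\mathcal T,[1],\Delta)$ be a triangulated category, and $\xi$ a proper class of triangles. Then there is a one-one correspondence between $\xi$-triangulated model structures on $\mathcal T$ and Hovey triples in $\mathcal T$ with respect to $\xi$, given by $$(\mathrm{CoFib},\ \mathrm{Fib},\ \mathrm{Weq})\mapsto(\mathcal C,\ \mathcal F,\ \mathcal W)$$ where $\mathcal C=\{\text{cofibrant objects}\}$, $\mathcal F=\{\text{fibrant objects}\}$, $\mathcal W=\{\text{trivial objects}\}$, with the inverse $(\mathcal C,\ \mathcal F,\ \mathcal W)\mapsto(\mathrm{CoFib},\ \mathrm{Fib},\ \mathrm{Weq})$, where $$\mathrm{CoFib}=\{\xi\text{-proper monomorphisms with hocokernel in }\mathcal C\},$$ $$\mathrm{Fib}=\{\xi\text{-proper epimorphisms with hokernel in }\mathcal F\},$$ $$\mathrm{Weq}=\{pi\mid i\text{ is a }\xi\text{-proper monomorphism with hocokernel in }\mathcal C\cap\mathcal W,\ p\text{ is a }\xi\text{-proper epimorphism with hokernel in }\mathcal F\cap\mathcal W\}.$$ If this is the case, then the homotopy category $\mathrm{Ho}(\mathcal T)$ is equivalent to the additive quotient $(\mathcal C\cap\mathcal F)/(\mathcal C\cap\mathcal F\cap\mathcal W)$.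
   Context: $(\mathcal T,[1],\Delta)$ denotes a triangulated category with suspension autoequivalence $[1]$ (quasi-inverse $[-1]$) and class $\Delta$ of (distinguished) triangles. A triangle $X\xrightarrow{u}Y\xrightarrow{v}Z\xrightarrow{w}X[1]$ is splitting if $w=0$. A class $\xi\subseteq\Delta$ is a proper class of triangles if: (i) it contains all splitting triangles; (ii) it is closed under isomorphisms of triangles, finite coproducts and suspensions (if $X\xrightarrow{u}Y\xrightarrow{v}Z\xrightarrow{w}X[1]$ is in $\xi$ then so is $X[i]\xrightarrow{(-1)^iu[i]}Y[i]\xrightarrow{(-1)^iv[i]}Z[i]\xrightarrow{(-1)^iw[i]}X[i+1]$ for all $i\in\mathbb Z$); (iii) it is closed under base changes (if $X\to Y\to Z\xrightarrow{w}X[1]$ is in $\xi$ and $\alpha:Z'\to Z$ is any morphism, then the triangle $X\to Y'\to Z'\xrightarrow{w\alpha}X[1]$ is in $\xi$) and cobase changes (if $X\to Y\to Z\xrightarrow{w}X[1]$ is in $\xi$ and $\beta:X\to X'$ is any morphism, then the triangle $X'\to Y'\to Z\xrightarrow{\beta[1]w}X'[1]$ is in $\xi$); (iv) it is saturated: for any triangle $X\to Y\to Z\xrightarrow{w}X[1]$ and any morphism $\alpha:Z'\to Z$ embedded in a triangle $X'\to Z'\xrightarrow{\alpha}Z\to X'[1]$ in $\xi$, if the base change $X\to Y'\to Z'\xrightarrow{w\alpha}X[1]$ is in $\xi$, then $X\to Y\to Z\xrightarrow{w}X[1]$ is in $\xi$. A morphism $u:X\to Y$ is a $\xi$-proper monomorphism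 if there is a triangle $X\xrightarrow{u}Y\to Z\to X[1]$ in $\xi$, and a $\xi$-proper epimorphism if there is a triangle $Z[-1]\to X\xrightarrow{u}Y\to Z$ in $\xi$. For $u:X\to Y$, the hocokernel is the object $Z$ in a triangle $X\xrightarrow{u}Y\to Z\to X[1]$, and the hokernel is the object $W$ in a triangle $W\to X\xrightarrow{u}Y\to W[1]$ (unique up to isomorphism). A model structure on a category is a triple $(\mathrm{CoFib},\mathrm{Fib},\mathrm{Weq})$ of classes of morphisms (cofibrations, fibrations, weak equivalences) satisfying: $\mathrm{Weq}$ has the two-out-of-three property; each class is closed under retracts; every commutative square with left side $i\in\mathrm{CoFib}$ and right side $p\in\mathrm{Fib}$ has a lifting if $i\in\mathrm{Weq}$ or $p\in\mathrm{Weq}$; every morphism factors as $pi=qj$ with $i\in\mathrm{CoFib}\cap\mathrm{Weq}$, $p\in\mathrm{Fib}$, $j\in\mathrm{CoFib}$, $q\in\mathrm{Fib}\cap\mathrm{Weq}$. (No existence of limits or colimits is assumed.) Trivial cofibrations (fibrations) are the cofibrations (fibrations) in $\mathrm{Weq}$. An object $X$ is cofibrant if $0\to X$ is a cofibration, fibrant if $X\to0$ is a fibration, trivial if $0\to X$ (equivalently $X\to0$) is a weak equivalence; trivially cofibrant (trivially fibrant) means trivial and cofibrant (fibrant). The homotopy category of a model structure on $\mathcal T$ is the localization $\mathrm{Ho}(\mathcal T)=\mathcal T[\mathrm{Weq}^{-1}]$. A model structure on $\mathcal T$ is $\xi$-triangulated if a morphism is a cofibration (respectively, trivial cofibration) if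 and only if it is a $\xi$-proper monomorphism with cofibrant (respectively, trivially cofibrant) hocokernel, and a morphism is a fibration (respectively, trivial fibration) if and only if it is a $\xi$-proper epimorphism with fibrant (respectively, trivially fibrant) hokernel. For objects $X,Y$, write $\mathrm{Ext}_\xi(X,Y)$ for the abelian group (under Baer sum) of equivalence classes of triangles $Y\to E\to X\to Y[1]$ in $\xi$, where two such triangles are equivalent if there is a morphism between them that is the identity on $Y$ and on $X$; thus $\mathrm{Ext}_\xi(X,Y)=0$ means that every triangle $Y\to E\to X\to Y[1]$ in $\xi$ splits. A pair $(\mathcal X,\mathcal Y)$ of classes of objects of $\mathcal T$ is a cotorsion pair with respect to $\xi$ if $\mathcal Y=\{Z\mid\mathrm{Ext}_\xi(X,Z)=0\ \forall X\in\mathcal X\}$ and $\mathcal X=\{Z\mid\mathrm{Ext}_\xi(Z,Y)=0\ \forall Y\in\mathcal Y\}$. It is complete if for every $T\in\mathcal T$ there are triangles $Y\to X\to T\to Y[1]$ and $T\to Y'\to X'\to T[1]$ in $\xi$ with $X,X'\in\mathcal X$ and $Y,Y'\in\mathcal Y$. A triple $(\mathcal C,\mathcal F,\mathcal W)$ of classes of objects of $\mathcal T$ is a Hovey triple in $\mathcal T$ with respect to $\xi$ if: (i) $\mathcal W$ is $\xi$-thick, i.e., closed under isomorphisms and direct summands, and if two of the three terms $X,Y,Z$ of a triangle $X\to Y\to Z\to X[1]$ in $\xi$ are in $\mathcal W$, then so is the third; (ii) $(\mathcal C,\mathcal F\cap\mathcal W)$ and $(\mathcal C\cap\mathcal W,\mathcal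 F)$ are complete cotorsion pairs with respect to $\xi$. For a full additive subcategory $\mathcal A$ and a full additive subcategory $\mathcal B\subseteq\mathcal A$, $\mathcal A/\mathcal B$ is the quotient of $\mathcal A$ by the ideal of morphisms factoring through objects of $\mathcal B$. *)

(* Defs.v *)
From HB Require Import structures.
From mathcomp Require Import all_boot all_algebra generic_quotient.
From mathcomp Require Import boolp classical_sets.

Set Implicit Arguments.
Unset Strict Implicit.
Unset Printing Implicit Defensive.

Import GRing.Theory.
Local Open Scope classical_set_scope.
Local Open Scope ring_scope.
Local Open Scope quotient_scope.

#[local] Obligation Tactic := idtac.

Declare Scope cat_scope.
Delimit Scope cat_scope with cat.
Open Scope cat_scope.

Record category := Category {
  ob :> Type;
  hom : ob -> ob -> Type;
  idm : forall X : ob, hom X X;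
  comp : forall X Y Z : ob, hom Y Z -> hom X Y -> hom X Z;
  comp_idl : forall (X Y : ob) (f : hom X Y), comp (idm Y) f = f;
  comp_idr : forall (X Y : ob) (f : hom X Y), comp f (idm X) = f;
  compA : forall (X Y Z T : ob) (h : hom Z T) (g : hom Y Z) (f : hom X Y),
    comp h (comp g f) = comp (comp h g) f }.
Arguments hom {c} X Y.
Arguments idm {c} X.
Notation "g ∘ f" := (comp g f) (at level 40, left associativity) : cat_scope.

Definition is_iso (C : category) (X Y : C) (f : hom X Y) : Prop :=
  exists g : hom Y X, g ∘ f = idm X /\ f ∘ g = idm Y.

Record functor (C D : category) := Functor {
  fobj :> C -> D;
  fmap : forall X Y : C, hom X Y -> hom (fobj X) (fobj Y);
  fmap_id : forall X : C, fmap (idm X) = idm (fobj X);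
  fmap_comp : forall (X Y Z : C) (g : hom Y Z) (f : hom X Y),
    fmap (g ∘ f) = fmap g ∘ fmap f }.
Arguments fmap {C D} F {X Y} f : rename.

Lemma functor_ext (C D : category) (o : C -> D) m i c m' i' c' :
  (forall X Y f, m X Y f = m' X Y f) ->
  @Functor C D o m i c = @Functor C D o m' i' c'.
Proof.
move=> E; have em : m = m'.
  apply: functional_extensionality_dep => X.
  apply: functional_extensionality_dep => Y.
  apply: functional_extensionality_dep => f; exact: E.
case: _ / em in i' c' *; congr Functor; exact: Prop_irrelevance.
Qed.

Definition functor_id (C : category) : functor C C :=
  @Functor C C id (fun _ _ f => f) (fun _ => erefl) (fun _ _ _ _ _ => erefl).

Program Definition functor_comp (C D E : category)
    (G : functor D E) (F : functor C D) : functor C E :=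
  @Functor C E (fun X => G (F X)) (fun _ _ f => fmap G (fmap F f)) _ _.
Next Obligation. by move=> C D E G F X /=; rewrite !fmap_id. Qed.
Next Obligation. by move=> C D E G F X Y Z g f /=; rewrite !fmap_comp. Qed.

Record nat_iso (C D : category) (F G : functor C D) := NatIso {
  nt : forall X : C, hom (F X) (G X);
  nt_inv : forall X : C, hom (G X) (F X);
  nt_invl : forall X : C, nt_inv X ∘ nt X = idm (F X);
  nt_invr : forall X : C, nt X ∘ nt_inv X = idm (G X);
  nt_nat : forall (X Y : C) (f : hom X Y), nt Y ∘ fmap F f = fmap G f ∘ nt X }.

Record equivalence (C D : category) := Equivalence {
  eqv_fun : functor C D;
  eqv_inv : functor D C;
  eqv_unit : nat_iso (functor_id C) (functor_comp eqv_inv eqv_fun);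
  eqv_counit : nat_iso (functor_comp eqv_fun eqv_inv) (functor_id D) }.

Definition equivalent (C D : category) : Prop := inhabited (equivalence C D).

Definition full_subcategory (C : category) (A : set C) : category :=
  @Category {X : C | A X} (fun X Y => hom (sval X) (sval Y))
    (fun X => idm (sval X)) (fun _ _ _ g f => g ∘ f)
    (fun _ _ f => comp_idl f) (fun _ _ f => comp_idr f)
    (fun _ _ _ _ h g f => compA h g f).

Section QuotientCategory.
Variables (C : category) (R : forall X Y : C, hom X Y -> hom X Y -> Prop).

Inductive congruence : forall X Y : C, hom X Y -> hom X Y -> Prop :=
| cong_base (X Y : C) (f g : hom X Y) : R f g -> congruence f g
| cong_refl (X Y : C) (f : hom X Y) : congruence f f
| cong_sym (X Y : C) (f g : hom X Y) : congruence f g -> congruence g f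
| cong_trans (X Y : C) (f g h : hom X Y) :
    congruence f g -> congruence g h -> congruence f h
| cong_comp (X Y Z : C) (g g' : hom Y Z) (f f' : hom X Y) :
    congruence g g' -> congruence f f' -> congruence (g ∘ f) (g' ∘ f').

Definition cong_rel (X Y : C) : rel {classic (hom X Y)} :=
  fun f g => `[< congruence f g >].

Lemma cong_rel_refl X Y : reflexive (@cong_rel X Y).
Proof. by move=> f; apply/asboolP/cong_refl. Qed.

Lemma cong_rel_sym X Y : symmetric (@cong_rel X Y).
Proof. by move=> f g; apply/asboolP/asboolP => /cong_sym. Qed.

Lemma cong_rel_trans X Y : transitive (@cong_rel X Y).
Proof.
by move=> g f h /asboolP fg /asboolP gh; apply/asboolP/(cong_trans fg gh).
Qed.

Canonical cong_equiv X Y := EquivRel (@cong_rel X Y)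
  (@cong_rel_refl X Y) (@cong_rel_sym X Y) (@cong_rel_trans X Y).

Definition qhom (X Y : C) : Type := {eq_quot (cong_equiv X Y)}.

Definition qclass (X Y : C) (f : hom X Y) : qhom X Y :=
  \pi_({eq_quot (cong_equiv X Y)}) f.

Definition qrepr (X Y : C) (a : qhom X Y) : hom X Y :=
  repr (a : {eq_quot (cong_equiv X Y)}).

Lemma qreprK X Y (a : qhom X Y) : qclass (qrepr a) = a.
Proof. exact: (@reprK _ {eq_quot (cong_equiv X Y)}). Qed.

Lemma qclassP X Y (f g : hom X Y) : qclass f = qclass g <-> congruence f g.
Proof.
split=> [/eqP|fg]; last by apply/eqP; rewrite eqmodE; apply/asboolP.
by rewrite eqmodE => /asboolP.
Qed.

Lemma qreprP X Y (f : hom X Y) : congruence (qrepr (qclass f)) f.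
Proof. by apply/qclassP; rewrite qreprK. Qed.

Definition qcomp X Y Z (b : qhom Y Z) (a : qhom X Y) : qhom X Z :=
  qclass (qrepr b ∘ qrepr a).

Lemma qcompE X Y Z (g : hom Y Z) (f : hom X Y) :
  qcomp (qclass g) (qclass f) = qclass (g ∘ f).
Proof. by apply/qclassP; apply: cong_comp; apply: qreprP. Qed.

Program Definition quotient_category : category :=
  @Category C qhom (fun X => qclass (idm X)) qcomp _ _ _.
Next Obligation.
by move=> X Y a; rewrite -(qreprK a) qcompE comp_idl.
Qed.
Next Obligation.
by move=> X Y a; rewrite -(qreprK a) qcompE comp_idr.
Qed.
Next Obligation.
move=> X Y Z T c b a.
by rewrite -(qreprK a) -(qreprK b) -(qreprK c) !qcompE compA.
Qed.

End QuotientCategory.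

Definition mor_class (C : category) := forall X Y : C, set (hom X Y).

Section Localization.
Variables (C : category) (W : mor_class C).

(* Words in the morphisms of C and formal inverses of the morphisms of W; a   *)
(* word is written from target to source, as compositions are.                *)
Inductive zigzag (X : C) : C -> Type :=
| zz_nil : zigzag X X
| zz_fwd (Y Z : C) : hom Y Z -> zigzag X Y -> zigzag X Z
| zz_bwd (Y Z : C) (s : hom Z Y) : W s -> zigzag X Y -> zigzag X Z.

Fixpoint zz_cat (X Y Z : C) (b : zigzag Y Z) : zigzag X Y -> zigzag X Z :=
  match b in zigzag _ T return zigzag X Y -> zigzag X T with
  | zz_nil => fun a => a
  | zz_fwd _ _ f b' => fun a => zz_fwd f (zz_cat b' a)
  | zz_bwd _ _ _ Ws b' => fun a => zz_bwd Ws (zz_cat b' a)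
  end.

Program Definition zigzag_category : category :=
  @Category C zigzag zz_nil zz_cat _ _ _.
Next Obligation. by []. Qed.
Next Obligation. by move=> X Y; elim=> [|T Z f a|T Z f Wf a] //= ->. Qed.
Next Obligation.
by move=> X Y Z T c b a; elim: c => [|T1 T2 f c|T1 T2 f Wf c] //= ->.
Qed.

Inductive zz_rel : forall X Y : zigzag_category, hom X Y -> hom X Y -> Prop :=
| zz_rel_id (X : C) :
    @zz_rel X X (zz_fwd (idm X) (zz_nil X)) (zz_nil X)
| zz_rel_comp (X Y Z : C) (g : hom Y Z) (f : hom X Y) :
    @zz_rel X Z (zz_fwd g (zz_fwd f (zz_nil X))) (zz_fwd (g ∘ f) (zz_nil X))
| zz_rel_invl (X Y : C) (s : hom X Y) (Ws : W s) :
    @zz_rel X X (zz_bwd Ws (zz_fwd s (zz_nil X))) (zz_nil X)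
| zz_rel_invr (X Y : C) (s : hom X Y) (Ws : W s) :
    @zz_rel Y Y (zz_fwd s (zz_bwd Ws (zz_nil Y))) (zz_nil Y).

Definition zz_class (X Y : C) (a : zigzag X Y) : qhom zz_rel X Y :=
  @qclass zigzag_category zz_rel X Y a.

Definition localization : category := quotient_category zz_rel.

Program Definition loc_functor : functor C localization :=
  @Functor C localization id (fun X _ f => zz_class (zz_fwd f (zz_nil X))) _ _.
Next Obligation. by move=> X; apply/qclassP/cong_base/zz_rel_id. Qed.
Next Obligation.
move=> X Y Z g f; rewrite [RHS]qcompE; apply/qclassP/cong_sym/cong_base.
exact: zz_rel_comp.
Qed.

Definition inverts (D : category) (F : functor C D) : Prop :=
  forall (X Y : C) (s : hom X Y), W s -> is_iso (fmap F s).

Lemma loc_functor_inverts : inverts loc_functor.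
Proof.
move=> X Y s Ws; exists (zz_class (zz_bwd Ws (zz_nil Y))).
split; rewrite [LHS]qcompE; apply/qclassP/cong_base.
  exact: zz_rel_invl.
exact: zz_rel_invr.
Qed.

Section UniversalProperty.
Variables (D : category) (F : functor C D) (invF : inverts F).

Fixpoint zz_eval (X Y : C) (a : zigzag X Y) : hom (F X) (F Y) :=
  match a in zigzag _ T return hom (F X) (F T) with
  | zz_nil => idm (F X)
  | zz_fwd _ _ f b => fmap F f ∘ zz_eval b
  | zz_bwd _ _ _ Ws b => sval (cid (invF Ws)) ∘ zz_eval b
  end.

Lemma zz_eval_cat X Y Z (b : zigzag Y Z) (a : zigzag X Y) :
  zz_eval (zz_cat b a) = zz_eval b ∘ zz_eval a.
Proof.
elim: b a => [|T1 T2 f b IH|T1 T2 f Wf b IH] a /=; first by rewrite comp_idl.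
  by rewrite IH compA.
by rewrite IH compA.
Qed.

Lemma zz_eval_cong (X Y : zigzag_category) (a b : hom X Y) :
  congruence zz_rel a b -> zz_eval a = zz_eval b.
Proof.
elim=> {X Y a b} [X Y a b||||]; last 4 first.
- by [].
- by move=> X Y a b _ ->.
- by move=> X Y a b c _ -> _ ->.
- by move=> X Y Z b b' a a' _ eb _ ea; rewrite !zz_eval_cat eb ea.
case=> {X Y a b} [X|X Y Z g f|X Y s Ws|X Y s Ws] /=; rewrite !comp_idr.
- by rewrite fmap_id.
- by rewrite fmap_comp.
- by case: cid => t [].
- by case: cid => t [].
Qed.

Program Definition loc_lift : functor localization D :=
  @Functor localization D F (fun _ _ a => zz_eval (qrepr a)) _ _.
Next Obligation. by move=> X; exact: (zz_eval_cong (qreprP _ _)). Qed.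
Next Obligation.
by move=> X Y Z b a; rewrite -zz_eval_cat; exact: (zz_eval_cong (qreprP _ _)).
Qed.

Lemma loc_lift_class (X Y : C) (f : hom X Y) :
  fmap loc_lift (fmap loc_functor f) = fmap F f.
Proof. by rewrite /= (zz_eval_cong (qreprP _ _)) /= comp_idr. Qed.

End UniversalProperty.

Lemma fmap_loc_eval (D : category) (G : functor localization D)
    (invG : inverts (functor_comp G loc_functor))
    (X Y : C) (a : zigzag X Y) :
  @fmap _ _ G X Y (zz_class a) = zz_eval invG a.
Proof.
elim: a => [|T Z f a IH|T Z s Ws a IH] /=.
- exact: (@fmap_id _ _ G X).
- by rewrite -IH -fmap_comp [_ ∘ _]qcompE.
rewrite (_ : zz_class _ = (zz_class (zz_bwd Ws (zz_nil T)) : @hom localization T Z)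
  ∘ zz_class a); last by rewrite [RHS]qcompE.
rewrite fmap_comp IH; congr (_ ∘ _); case: cid => t /= [ts st].
rewrite -[LHS]comp_idr -st compA -fmap_comp [X in fmap G X]qcompE.
rewrite (_ : qclass _ _ = idm (Z : localization)) ?fmap_id ?comp_idl //.
exact/qclassP/cong_base/zz_rel_invl.
Qed.

Theorem localization_universal (D : category) (F : functor C D) : inverts F ->
  exists! G : functor localization D, functor_comp G loc_functor = F.
Proof.
move=> invF; exists (loc_lift invF); split.
  have := loc_lift_class invF; case: F invF => o m i c invF E.
  exact: functor_ext.
move=> G GF; subst F.
have E X Y (a : @hom localization X Y) : zz_eval invF (qrepr a) = fmap G a.
  by rewrite -fmap_loc_eval /zz_class qreprK.
by case: G invF E => o m i c invF E; apply: functor_ext.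
Qed.

End Localization.

Record preadditive := Preadditive {
  preadd_cat :> category;
  hom_zmod : forall X Y : preadd_cat, GRing.Zmodule (@hom preadd_cat X Y) }.

HB.instance Definition _ (A : preadditive) (X Y : A) := hom_zmod X Y.

Record additive := Additive {
  add_preadd :> preadditive;
  compDl : forall (X Y Z : add_preadd) (g h : hom Y Z) (f : hom X Y),
    (g + h) ∘ f = g ∘ f + h ∘ f;
  compDr : forall (X Y Z : add_preadd) (g : hom Y Z) (f h : hom X Y),
    g ∘ (f + h) = g ∘ f + g ∘ h;
  zob : add_preadd;
  idm_zob : idm zob = 0;
  bip : add_preadd -> add_preadd -> add_preadd;
  injl : forall X Y : add_preadd, hom X (bip X Y);
  injr : forall X Y : add_preadd, hom Y (bip X Y);
  prl : forall X Y : add_preadd, hom (bip X Y) X;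
  prr : forall X Y : add_preadd, hom (bip X Y) Y;
  prl_injl : forall X Y : add_preadd, prl X Y ∘ injl X Y = idm X;
  prr_injr : forall X Y : add_preadd, prr X Y ∘ injr X Y = idm Y;
  prl_injr : forall X Y : add_preadd, prl X Y ∘ injr X Y = 0;
  prr_injl : forall X Y : add_preadd, prr X Y ∘ injl X Y = 0;
  injl_prlD : forall X Y : add_preadd,
    injl X Y ∘ prl X Y + injr X Y ∘ prr X Y = idm (bip X Y) }.
Arguments zob {a}.
Arguments bip {a} X Y.
Arguments injl {a} X Y.
Arguments injr {a} X Y.
Arguments prl {a} X Y.
Arguments prr {a} X Y.

Definition bip_map (T : additive) (X X' Y Y' : T) (f : hom X Y) (g : hom X' Y') :
    hom (bip X X') (bip Y Y') :=
  injl Y Y' ∘ f ∘ prl X X' + injr Y Y' ∘ g ∘ prr X X'.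

Definition factors_through (T : additive) (B : set T) (X Y : T) (f : hom X Y) : Prop :=
  exists (Z : T) (a : hom X Z) (b : hom Z Y), B Z /\ f = b ∘ a.

Definition ideal_rel (T : additive) (A B : set T) (X Y : full_subcategory A)
    (f g : @hom T (sval X) (sval Y)) : Prop :=
  factors_through B (f - g).

(* A/B. When B contains 0 and is closed under finite direct sums, the         *)
(* relation is already a congruence: see [ideal_rel_congruence].               *)
Definition additive_quotient (T : additive) (A B : set T) : category :=
  quotient_category (@ideal_rel T A B).

Section AdditiveQuotient.
Variables (T : additive) (A B : set T).
Hypotheses (B0 : B zob) (BD : forall X Y : T, B X -> B Y -> B (bip X Y)).

Lemma comp0r (X Y Z : T) (g : hom Y Z) : g ∘ (0 : hom X Y) = 0.
Proof. by apply: (addrI (g ∘ 0)); rewrite -compDr !addr0. Qed.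

Lemma comp0l (X Y Z : T) (f : hom X Y) : (0 : hom Y Z) ∘ f = 0.
Proof. by apply: (addrI (0 ∘ f)); rewrite -compDl !addr0. Qed.

Lemma compNr (X Y Z : T) (g : hom Y Z) (f : hom X Y) : g ∘ (- f) = - (g ∘ f).
Proof. by apply: (addrI (g ∘ f)); rewrite -compDr !subrr comp0r. Qed.

Lemma compNl (X Y Z : T) (g : hom Y Z) (f : hom X Y) : (- g) ∘ f = - (g ∘ f).
Proof. by apply: (addrI (g ∘ f)); rewrite -compDl !subrr comp0l. Qed.

Lemma factors_throughD (X Y : T) (f g : hom X Y) :
  factors_through B f -> factors_through B g -> factors_through B (f + g).
Proof.
move=> [Z [a [b [BZ ->]]]] [Z' [a' [b' [BZ' ->]]]].
exists (bip Z Z'), (injl Z Z' ∘ a + injr Z Z' ∘ a'), (b ∘ prl Z Z' + b' ∘ prr Z Z').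
split; first exact: BD.
have E (U V W W' : T) (k : hom V Y) (p : hom U V) (i : hom W U) (l : hom W' W) :
    (k ∘ p) ∘ (i ∘ l) = k ∘ (p ∘ i) ∘ l by rewrite !compA.
rewrite compDl !compDr !E prl_injl prr_injr prl_injr prr_injl.
by rewrite !comp_idr !comp0r !comp0l addr0 add0r.
Qed.

Lemma factors_throughN (X Y : T) (f : hom X Y) :
  factors_through B f -> factors_through B (- f).
Proof. by move=> [Z [a [b [BZ ->]]]]; exists Z, a, (- b); rewrite compNl. Qed.

Lemma ideal_rel_congruence (X Y : full_subcategory A) (f g : hom X Y) :
  congruence (@ideal_rel T A B) f g <-> ideal_rel B f g.
Proof.
split=> [|fg]; last exact: cong_base.
elim=> {X Y f g}.
- by [].
- by move=> X Y f; exists zob, (0 : @hom T _ _), (0 : @hom T _ _); rewrite comp0r subrr.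
- by move=> X Y f g _ /factors_throughN; rewrite opprB.
- move=> X Y f g h _ fg _ gh.
  by have := factors_throughD fg gh; rewrite addrA subrK.
- move=> X Y Z g g' f f' _ [U [a [b [BU E]]]] _ [V [c [d [BV E']]]].
  have -> : ideal_rel B (g ∘ f) (g' ∘ f') = factors_through B
      ((g - g' : @hom T _ _) ∘ (f : @hom T _ _)
        + (g' : @hom T _ _) ∘ (f - f' : @hom T _ _)).
    congr factors_through.
    by rewrite compDl compDr compNl compNr addrA subrK.
  apply: factors_throughD.
    by exists U, ((a : @hom T _ _) ∘ (f : @hom T _ _)), b; rewrite E compA.
  by exists V, c, ((g' : @hom T _ _) ∘ (d : @hom T _ _)); rewrite E' compA.
Qed.

End AdditiveQuotient.

(* The suspension is an autoequivalence with a chosen quasi-inverse; [susp_adj] *)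
(* says that the chosen unit and counit form an adjoint equivalence, so that    *)
(* the identifications X[-1][1] = X = X[1][-1] are compatible.                  *)
Record suspended := Suspended {
  susp_add :> additive;
  susp : equivalence susp_add susp_add;
  susp_adj : forall X : susp_add,
    nt (eqv_counit susp) (eqv_fun susp X)
      ∘ fmap (eqv_fun susp) (nt (eqv_unit susp) X) = idm (eqv_fun susp X);
  suspD : forall (X Y : susp_add) (f g : hom X Y),
    fmap (eqv_fun susp) (f + g)
      = fmap (eqv_fun susp) f + fmap (eqv_fun susp) g }.

Notation shift T := (eqv_fun (susp T)).
Notation unshift T := (eqv_inv (susp T)).
Notation "X ⟦1⟧" := (fobj (shift _) X) (at level 2, format "X ⟦1⟧") : cat_scope.
Notation "X ⟦-1⟧" := (fobj (unshift _) X) (at level 2, format "X ⟦-1⟧") : cat_scope.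
Notation "f ⟪1⟫" := (fmap (shift _) f) (at level 2, format "f ⟪1⟫") : cat_scope.
Notation "f ⟪-1⟫" := (fmap (unshift _) f) (at level 2, format "f ⟪-1⟫") : cat_scope.

(* The canonical isomorphisms X[1][-1] -> X and X -> X[-1][1].                *)
Definition unit_inv (T : suspended) (X : T) : hom (X⟦1⟧⟦-1⟧) X :=
  nt_inv (eqv_unit (susp T)) X.
Definition counit_inv (T : suspended) (X : T) : hom X (X⟦-1⟧⟦1⟧) :=
  nt_inv (eqv_counit (susp T)) X.

Record triangle (T : suspended) := Tri {
  tX : T; tY : T; tZ : T;
  tu : hom tX tY;
  tv : hom tY tZ;
  tw : hom tZ (tX⟦1⟧) }.
Arguments Tri {T tX tY tZ} tu tv tw.

Section Triangles.
Variable T : suspended.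
Implicit Types t : triangle T.

Definition triangle_mor t t' (f : hom (tX t) (tX t')) (g : hom (tY t) (tY t'))
    (h : hom (tZ t) (tZ t')) : Prop :=
  [/\ g ∘ tu t = tu t' ∘ f, h ∘ tv t = tv t' ∘ g & f⟪1⟫ ∘ tw t = tw t' ∘ h].

Definition triangle_iso t t' : Prop :=
  exists f g h, [/\ @triangle_mor t t' f g h, is_iso f, is_iso g & is_iso h].

Definition triangle_rot t : triangle T := Tri (tv t) (tw t) (- (tu t)⟪1⟫).

Definition triangle_sum t t' : triangle T :=
  Tri (bip_map (tu t) (tu t')) (bip_map (tv t) (tv t'))
    ((injl (tX t) (tX t'))⟪1⟫ ∘ tw t ∘ prl _ _
      + (injr (tX t) (tX t'))⟪1⟫ ∘ tw t' ∘ prr _ _).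

Definition triangle_shift t : triangle T :=
  Tri (- (tu t)⟪1⟫) (- (tv t)⟪1⟫) (- (tw t)⟪1⟫).

Definition triangle_unshift t : triangle T :=
  Tri (- (tu t)⟪-1⟫) (- (tv t)⟪-1⟫)
    (- (counit_inv (tX t) ∘ unit_inv (tX t) ∘ (tw t)⟪-1⟫)).

(* The signs accumulate to (-1)^i, the suspension functors being additive.    *)
Definition triangle_shiftz (i : int) t : triangle T :=
  match i with
  | Posz n => iter n triangle_shift t
  | Negz n => iter n.+1 triangle_unshift t
  end.

End Triangles.

Record triangulated := Triangulated {
  tri_susp :> suspended;
  dist : set (triangle tri_susp);
  dist_iso : forall t t', dist t -> triangle_iso t t' -> dist t';
  dist_id : forall X : tri_susp,
    dist (Tri (idm X) (0 : hom X zob) (0 : hom zob (X⟦1⟧)));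
  dist_ex : forall (X Y : tri_susp) (u : hom X Y),
    exists (Z : tri_susp) (v : hom Y Z) (w : hom Z (X⟦1⟧)), dist (Tri u v w);
  dist_rot : forall t, dist t <-> dist (triangle_rot t);
  dist_mor : forall t t' (f : hom (tX t) (tX t')) (g : hom (tY t) (tY t')),
    dist t -> dist t' -> g ∘ tu t = tu t' ∘ f -> exists h, triangle_mor f g h;
  dist_oct : forall (X Y Z X' Y' Z' : tri_susp) (u : hom X Y) (v : hom Y Z)
      (a : hom Y Z') (b : hom Z' (X⟦1⟧)) (c : hom Z X') (d : hom X' (Y⟦1⟧))
      (e : hom Z Y') (f : hom Y' (X⟦1⟧)),
    dist (Tri u a b) -> dist (Tri v c d) -> dist (Tri (v ∘ u) e f) ->
    exists (g : hom Z' Y') (h : hom Y' X'),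
      [/\ dist (Tri g h (a⟪1⟫ ∘ d)), g ∘ a = e ∘ v, f ∘ g = b,
          h ∘ e = c & d ∘ h = u⟪1⟫ ∘ f] }.
Arguments dist : clear implicits.

Section ProperClass.
Variables (T : triangulated) (xi : set (triangle T)).

(* Finite coproducts are binary ones and the zero triangle, which is          *)
(* splitting.                                                                 *)
Record proper_class : Prop := ProperClass {
  pc_dist : xi `<=` dist T;
  pc_split : forall t, dist T t -> tw t = 0 -> xi t;
  pc_iso : forall t t', xi t -> triangle_iso t t' -> xi t';
  pc_sum : forall t t', xi t -> xi t' -> xi (triangle_sum t t');
  pc_shift : forall (i : int) t, xi t -> xi (triangle_shiftz i t);
  pc_base : forall (X Y Z Y' Z' : T) (u : hom X Y) (v : hom Y Z)
      (w : hom Z (X⟦1⟧)) (al : hom Z' Z) (u' : hom X Y') (v' : hom Y' Z'),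
    xi (Tri u v w) -> dist T (Tri u' v' (w ∘ al)) -> xi (Tri u' v' (w ∘ al));
  pc_cobase : forall (X Y Z X' Y' : T) (u : hom X Y) (v : hom Y Z)
      (w : hom Z (X⟦1⟧)) (be : hom X X') (u' : hom X' Y') (v' : hom Y' Z),
    xi (Tri u v w) -> dist T (Tri u' v' (be⟪1⟫ ∘ w)) ->
    xi (Tri u' v' (be⟪1⟫ ∘ w));
  pc_sat : forall (X Y Z X' Y' Z' : T) (u : hom X Y) (v : hom Y Z)
      (w : hom Z (X⟦1⟧)) (x : hom X' Z') (al : hom Z' Z) (y : hom Z (X'⟦1⟧))
      (u' : hom X Y') (v' : hom Y' Z'),
    dist T (Tri u v w) -> xi (Tri x al y) -> xi (Tri u' v' (w ∘ al)) ->
    xi (Tri u v w) }.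

Definition proper_mono (X Y : T) (u : hom X Y) : Prop :=
  exists (Z : T) (v : hom Y Z) (w : hom Z (X⟦1⟧)), xi (Tri u v w).

Definition proper_epi (X Y : T) (u : hom X Y) : Prop :=
  exists (Z : T) (a : hom (Z⟦-1⟧) X) (c : hom Y Z),
    xi (Tri a u (counit_inv Z ∘ c)).

Definition hocokernel (X Y : T) (u : hom X Y) (Z : T) : Prop :=
  exists (v : hom Y Z) (w : hom Z (X⟦1⟧)), dist T (Tri u v w).

Definition hokernel (X Y : T) (u : hom X Y) (W : T) : Prop :=
  exists (a : hom W X) (c : hom Y (W⟦1⟧)), dist T (Tri a u c).

Definition mono_in (A : set T) : mor_class T := fun X Y u =>
  proper_mono u /\ exists2 Z, hocokernel u Z & A Z.

Definition epi_in (A : set T) : mor_class T := fun X Y u =>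
  proper_epi u /\ exists2 W, hokernel u W & A W.

(* Ext_xi(X, Y) = 0. *)
Definition Ext_zero (X Y : T) : Prop :=
  forall (E : T) (u : hom Y E) (v : hom E X) (w : hom X (Y⟦1⟧)),
    xi (Tri u v w) -> w = 0.

Definition cotorsion_pair (A B : set T) : Prop :=
  B = [set Z | forall X, A X -> Ext_zero X Z] /\
  A = [set Z | forall Y, B Y -> Ext_zero Z Y].

Definition complete_pair (A B : set T) : Prop := forall Z : T,
  (exists (X Y : T) (u : hom Y X) (v : hom X Z) (w : hom Z (Y⟦1⟧)),
     [/\ xi (Tri u v w), A X & B Y]) /\
  (exists (X Y : T) (u : hom Z Y) (v : hom Y X) (w : hom X (Z⟦1⟧)),
     [/\ xi (Tri u v w), A X & B Y]).

Definition thick (W : set T) : Prop :=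
  [/\ forall (X Y : T) (f : hom X Y), is_iso f -> W X -> W Y,
      forall X Y : T, W (bip X Y) -> W X /\ W Y &
      forall t, xi t -> [/\ W (tX t) -> W (tY t) -> W (tZ t),
                            W (tX t) -> W (tZ t) -> W (tY t) &
                            W (tY t) -> W (tZ t) -> W (tX t)]].

End ProperClass.

Record ob_triple (C : category) := ObTriple {
  obC : set C; obF : set C; obW : set C }.

Record mor_triple (C : category) := MorTriple {
  CoFib : mor_class C; Fib : mor_class C; Weq : mor_class C }.
Arguments CoFib {C} m {X Y} : rename.
Arguments Fib {C} m {X Y} : rename.
Arguments Weq {C} m {X Y} : rename.

Definition hovey_triple (T : triangulated) (xi : set (triangle T))
    (H : ob_triple T) : Prop :=
  [/\ thick xi (obW H),
      cotorsion_pair xi (obC H) (obF H `&` obW H)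
        /\ complete_pair xi (obC H) (obF H `&` obW H) &
      cotorsion_pair xi (obC H `&` obW H) (obF H)
        /\ complete_pair xi (obC H `&` obW H) (obF H)].

Section Model.
Variable C : category.

Definition retract (X Y X' Y' : C) (f : hom X Y) (g : hom X' Y') : Prop :=
  exists (i : hom X X') (r : hom X' X) (j : hom Y Y') (s : hom Y' Y),
    [/\ r ∘ i = idm X, s ∘ j = idm Y, g ∘ i = j ∘ f & f ∘ r = s ∘ g].

Definition retract_closed (S : mor_class C) : Prop :=
  forall (X Y X' Y' : C) (f : hom X Y) (g : hom X' Y'),
    retract f g -> S _ _ g -> S _ _ f.

Definition two_out_of_three (S : mor_class C) : Prop :=
  forall (X Y Z : C) (f : hom X Y) (g : hom Y Z),
    [/\ S _ _ f -> S _ _ g -> S _ _ (g ∘ f),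
        S _ _ f -> S _ _ (g ∘ f) -> S _ _ g &
        S _ _ g -> S _ _ (g ∘ f) -> S _ _ f].

Definition lifts (A B X Y : C) (i : hom A B) (p : hom X Y) : Prop :=
  forall (f : hom A X) (g : hom B Y), p ∘ f = g ∘ i ->
    exists h : hom B X, h ∘ i = f /\ p ∘ h = g.

Record model_structure (M : mor_triple C) : Prop := ModelStructure {
  ms_2of3 : two_out_of_three (@Weq _ M);
  ms_cofib_retract : retract_closed (@CoFib _ M);
  ms_fib_retract : retract_closed (@Fib _ M);
  ms_weq_retract : retract_closed (@Weq _ M);
  ms_lift : forall (A B X Y : C) (i : hom A B) (p : hom X Y),
    CoFib M i -> Fib M p -> Weq M i \/ Weq M p -> lifts i p;
  ms_factor : forall (X Y : C) (f : hom X Y),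
    (exists (Z : C) (i : hom X Z) (p : hom Z Y),
       [/\ CoFib M i, Weq M i, Fib M p & f = p ∘ i]) /\
    (exists (Z : C) (j : hom X Z) (q : hom Z Y),
       [/\ CoFib M j, Fib M q, Weq M q & f = q ∘ j]) }.

Definition Ho (M : mor_triple C) : category := localization (@Weq _ M).

End Model.

Section Correspondence.
Variables (T : triangulated) (xi : set (triangle T)).

Definition cofibrant (M : mor_triple T) : set T :=
  [set X | CoFib M (0 : hom zob X)].
Definition fibrant (M : mor_triple T) : set T :=
  [set X | Fib M (0 : hom X zob)].
Definition trivial_ob (M : mor_triple T) : set T :=
  [set X | Weq M (0 : hom zob X)].

Record xi_triangulated_model (M : mor_triple T) : Prop := XiTriangulatedModel {
  xtm_model : model_structure M;
  xtm_cofib : forall (X Y : T) (f : hom X Y),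
    CoFib M f <-> mono_in xi (cofibrant M) f;
  xtm_tcofib : forall (X Y : T) (f : hom X Y),
    CoFib M f /\ Weq M f <-> mono_in xi (cofibrant M `&` trivial_ob M) f;
  xtm_fib : forall (X Y : T) (f : hom X Y),
    Fib M f <-> epi_in xi (fibrant M) f;
  xtm_tfib : forall (X Y : T) (f : hom X Y),
    Fib M f /\ Weq M f <-> epi_in xi (fibrant M `&` trivial_ob M) f }.

Definition hovey_of_model (M : mor_triple T) : ob_triple T :=
  ObTriple (cofibrant M) (fibrant M) (trivial_ob M).

Definition model_of_hovey (H : ob_triple T) : mor_triple T :=
  MorTriple (mono_in xi (obC H)) (epi_in xi (obF H))
    (fun X Y f => exists (Z : T) (i : hom X Z) (p : hom Z Y),
       [/\ mono_in xi (obC H `&` obW H) i,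
           epi_in xi (obF H `&` obW H) p & f = p ∘ i]).

End Correspondence.

(* Main.v *)
(* A xi-triangle is determined by its third map, and the third maps of          *)
(* xi-triangles ("phantom maps") form a two-sided ideal which is saturated both *)
(* under xi-proper epimorphisms and, dually, under xi-proper monomorphisms.     *)
(* They play the role of Ext^1, so the arguments for exact categories apply.    *)
(* A square lifts as soon as Ext_xi(hocokernel, hokernel) = 0. To factor        *)
(* f : X -> Y, take a xi-proper monomorphism u from X into an object B of the   *)
(* right-hand class and pull back an approximation of the hocokernel of (u, f)  *)
(* along B + Y. Given a Hovey triple, the composite p i of a cofibration i with *)
(* a trivial fibration p is a weak equivalence iff the hocokernel of i is in W; *)
(* up to W, the hocokernels obtained for f, g f and g fit in one xi-triangle,   *)
(* whence two-out-of-three. Finally Ho(T) is computed by bifibrant replacement, *)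
(* which is functorial modulo the maps factoring through objects that are       *)
(* cofibrant, fibrant and trivial.                                              *)

From Pilot Require Import Defs.
From mathcomp Require Import all_boot all_algebra boolp classical_sets.

Set Implicit Arguments.
Unset Strict Implicit.
Unset Printing Implicit Defensive.

Import GRing.Theory.
(* [hom] and [additive] would otherwise denote their namesakes in MathComp.   *)
Import Pilot.Defs.
Local Open Scope classical_set_scope.
Local Open Scope ring_scope.

(** Whether a triangle lies in [xi] depends only on its third map ([phantom_xi]), so Ext_xi(Z, X)
    sits inside [hom Z (X⟦1⟧)] as the phantom maps. Being phantom can be tested after composing with
    a [xi]-proper epimorphism ([phantom_sat]) or monomorphism ([phantom_cosat]). Together with the
    octahedral axiom this yields the calculus of an exact category: composites and cancellation of
    proper maps, pullbacks ([dist_pullback]), and triangles relating kernels and cones of a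
    composite ([xi_ker_cone], [xi_ker_cones]).

    From a Hovey triple to a model structure, orthogonality gives the liftings ([lifts_Ext]) and
    completeness the factorizations ([cotorsion_factor]). The delicate class is [Weq]. By
    [thick_factor_cone], the cone of the cofibration part of a map lies in [W] for one factorization
    if and only if it does for every other, so it is a test for weak equivalence ([weq_cone]). By
    [thick_square_cone], two-out-of-three becomes thickness of [W] on one triangle. Closure under
    retracts is reduced to the case of a fibration, where the retract argument applies.

    Conversely, lifting against [0 -> X] splits the triangles that must split, and factoring
    [0 -> Z] and [Z -> 0] provides the approximations. Thickness of the trivial objects rests on
    [weq_xi_mono], which detects a weak equivalence among proper monomorphisms by its cone.

    For the homotopy category, bifibrant replacement inverts weak equivalences modulo null maps by a
    Whitehead argument ([weq_bifibrant]), while maps that differ by a null map agree in [Ho]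
    ([loc_null]); the replacement and the inclusion are then quasi-inverse. *)

Lemma is_iso_idm (C : category) (X : C) : is_iso (idm X).
Proof. by exists (idm X); rewrite comp_idl. Qed.

Lemma is_iso_comp (C : category) (X Y Z : C) (g : hom Y Z) (f : hom X Y) :
  is_iso g -> is_iso f -> is_iso (g ∘ f).
Proof.
move=> [g' [g'g gg']] [f' [f'f ff']]; exists (f' ∘ g'); split.
  by rewrite compA -(compA f') g'g comp_idr f'f.
by rewrite compA -(compA g) ff' comp_idr gg'.
Qed.

(** * Additive categories, equivalences and the suspension *)

Section Additive.
Variable A : additive.
Implicit Types X Y Z : A.

Lemma compBl X Y Z (g h : hom Y Z) (f : hom X Y) : (g - h) ∘ f = g ∘ f - h ∘ f.
Proof. by rewrite compDl compNl. Qed.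

Lemma compBr X Y Z (g : hom Y Z) (f h : hom X Y) : g ∘ (f - h) = g ∘ f - g ∘ h.
Proof. by rewrite compDr compNr. Qed.

Lemma hom_to_zob X (f : hom X zob) : f = 0.
Proof. by rewrite -[f]comp_idl idm_zob comp0l. Qed.

Lemma hom_from_zob X (f : hom zob X) : f = 0.
Proof. by rewrite -[f]comp_idr idm_zob comp0r. Qed.

Lemma bip_hom_ext X Y Z (f g : hom (bip X Y) Z) :
  f ∘ injl X Y = g ∘ injl X Y -> f ∘ injr X Y = g ∘ injr X Y -> f = g.
Proof.
move=> el er; rewrite -[f]comp_idr -[g]comp_idr -injl_prlD !compDr !compA.
by rewrite el er.
Qed.

Lemma copair_injl X Y Z (f : hom X Z) (g : hom Y Z) :
  (f ∘ prl X Y + g ∘ prr X Y) ∘ injl X Y = f.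
Proof. by rewrite compDl -!compA prl_injl prr_injl comp0r addr0 comp_idr. Qed.

Lemma copair_injr X Y Z (f : hom X Z) (g : hom Y Z) :
  (f ∘ prl X Y + g ∘ prr X Y) ∘ injr X Y = g.
Proof. by rewrite compDl -!compA prl_injr prr_injr comp0r add0r comp_idr. Qed.

Lemma is_iso_opp X Y (f : hom X Y) : is_iso f -> is_iso (- f).
Proof.
by move=> [g [gf fg]]; exists (- g); rewrite !compNl !compNr !opprK.
Qed.

Lemma is_iso_zero X Y : idm X = 0 -> idm Y = 0 -> is_iso (0 : hom X Y).
Proof. by move=> X0 Y0; exists 0; rewrite !comp0r X0 Y0. Qed.

End Additive.

Section Equivalence.
Variables (C D : category) (E : equivalence C D).
Notation S := (eqv_fun E).
Notation S' := (eqv_inv E).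

Lemma eqv_fun_faithful (X Y : C) (f g : hom X Y) : fmap S f = fmap S g -> f = g.
Proof.
suff nat k : k = nt_inv (eqv_unit E) Y ∘ fmap S' (fmap S k) ∘ nt (eqv_unit E) X.
  by move=> e; rewrite (nat f) e -nat.
have := nt_nat (eqv_unit E) k; rewrite /= -compA => <-.
by have := nt_invl (eqv_unit E) Y; rewrite compA /= => ->; rewrite comp_idl.
Qed.

Lemma eqv_inv_faithful (X Y : D) (f g : hom X Y) : fmap S' f = fmap S' g -> f = g.
Proof.
suff nat k : k = nt (eqv_counit E) Y ∘ fmap S (fmap S' k) ∘ nt_inv (eqv_counit E) X.
  by move=> e; rewrite (nat f) e -nat.
have := nt_nat (eqv_counit E) k; rewrite /= => ->.
by have := nt_invr (eqv_counit E) X; rewrite -compA /= => ->; rewrite comp_idr.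
Qed.

(** The preimage built from the unit has, after [S], the same image as [g] under the quasi-inverse,
    which is faithful. *)
Lemma eqv_fun_full (X Y : C) (g : hom (S X) (S Y)) : exists f, g = fmap S f.
Proof.
pose f : hom X Y := nt_inv (eqv_unit E) Y ∘ fmap S' g ∘ nt (eqv_unit E) X.
exists f; apply: eqv_inv_faithful.
have := nt_nat (eqv_unit E) f; rewrite /= {1}/f !compA.
have /= -> := nt_invr (eqv_unit E) Y; rewrite comp_idl.
move=> /(congr1 (fun k => k ∘ nt_inv (eqv_unit E) X)).
by rewrite -!compA; have /= -> := nt_invr (eqv_unit E) X; rewrite !comp_idr.
Qed.

Lemma eqv_fun_iso (X Y : C) (f : hom X Y) : is_iso (fmap S f) -> is_iso f.
Proof.
move=> [g]; have [g' ->] := eqv_fun_full g; rewrite -!fmap_comp -!fmap_id.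
by move=> [/eqv_fun_faithful gf /eqv_fun_faithful fg]; exists g'.
Qed.

End Equivalence.

Section Shift.
Variable T : suspended.
Implicit Types X Y : T.

Lemma shift0 X Y : (0 : hom X Y)⟪1⟫ = 0.
Proof. by apply: (addrI ((0 : hom X Y)⟪1⟫)); rewrite -suspD !addr0. Qed.

Lemma shiftN X Y (f : hom X Y) : (- f)⟪1⟫ = - f⟪1⟫.
Proof. by apply: (addrI f⟪1⟫); rewrite -suspD !subrr shift0. Qed.

Lemma shift_inj X Y (f g : hom X Y) : f⟪1⟫ = g⟪1⟫ -> f = g.
Proof. exact: eqv_fun_faithful. Qed.

Lemma shift_full X Y (g : hom (X⟦1⟧) (Y⟦1⟧)) : exists f : hom X Y, g = f⟪1⟫.
Proof. exact: eqv_fun_full. Qed.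

Lemma shift_zob : idm ((zob : T)⟦1⟧) = 0.
Proof. by rewrite -fmap_id idm_zob shift0. Qed.

Lemma shift_ess X : exists Y (f : hom X (Y⟦1⟧)), is_iso f.
Proof.
exists (X⟦-1⟧), (counit_inv X), (nt (eqv_counit (susp T)) X).
by split; [have := nt_invr (eqv_counit (susp T)) X | have := nt_invl (eqv_counit (susp T)) X].
Qed.

End Shift.

(** * Triangulated categories *)

Section Triangulated.
Variable T : triangulated.
Implicit Types X Y Z A : T.

Lemma dist_rot1 X Y Z (u : hom X Y) (v : hom Y Z) (w : hom Z (X⟦1⟧)) :
  dist T (Tri u v w) -> dist T (Tri v w (- u⟪1⟫)).
Proof. by move/dist_rot. Qed.

Lemma dist_rot2 X Y Z (u : hom X Y) (v : hom Y Z) (w : hom Z (X⟦1⟧)) :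
  dist T (Tri u v w) <-> dist T (Tri w (- u⟪1⟫) (- v⟪1⟫)).
Proof. by split=> [/dist_rot/dist_rot //|D]; apply/dist_rot/dist_rot. Qed.

Lemma dist_fill X Y Z X' Y' Z' (u : hom X Y) (v : hom Y Z) (w : hom Z (X⟦1⟧))
    (u' : hom X' Y') (v' : hom Y' Z') (w' : hom Z' (X'⟦1⟧)) f g :
  dist T (Tri u v w) -> dist T (Tri u' v' w') -> g ∘ u = u' ∘ f ->
  exists h, h ∘ v = v' ∘ g /\ f⟪1⟫ ∘ w = w' ∘ h.
Proof.
move=> D D' E; have [h [_ E1 E2]] := dist_mor (t := Tri u v w) (t' := Tri u' v' w') D D' E.
by exists h.
Qed.

Lemma dist_comp_vu X Y Z (u : hom X Y) (v : hom Y Z) w :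
  dist T (Tri u v w) -> v ∘ u = 0.
Proof.
move=> D.
by have [h [<- _]] := dist_fill (dist_id X) D (erefl (u ∘ idm X)); rewrite comp0r.
Qed.

Lemma dist_comp_wv X Y Z (u : hom X Y) (v : hom Y Z) w :
  dist T (Tri u v w) -> w ∘ v = 0.
Proof. by move/dist_rot1/dist_comp_vu. Qed.

Lemma dist_comp_uw X Y Z (u : hom X Y) (v : hom Y Z) w :
  dist T (Tri u v w) -> u⟪1⟫ ∘ w = 0.
Proof.
by move/dist_rot2/dist_comp_vu/eqP; rewrite compNl oppr_eq0 => /eqP.
Qed.

Lemma dist_id_zob X : dist T (Tri (0 : hom zob X) (idm X) (0 : hom X (zob⟦1⟧))).
Proof.
apply/dist_rot; apply: (dist_iso (dist_id X)).
exists (idm X), (idm X), (0 : hom zob (zob⟦1⟧)); split=> //=.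
- by split=> /=; rewrite ?comp_idl ?comp_idr ?comp0r // [RHS]hom_from_zob [LHS]hom_from_zob.
- exact: is_iso_idm.
- exact: is_iso_idm.
- by apply: is_iso_zero; [exact: idm_zob | exact: shift_zob].
Qed.

(** Exactness of Hom(A, -): fill in a morphism from the rotated triangle A -> 0 -> A[1] and
    desuspend its third component. The five lemmas that follow are the rotated and dual forms. *)
Lemma dist_lift_v X Y Z (u : hom X Y) (v : hom Y Z) w A (f : hom A Y) :
  dist T (Tri u v w) -> v ∘ f = 0 -> exists g, f = u ∘ g.
Proof.
move=> D vf.
have [|h [_]] := @dist_fill _ _ _ _ _ _ _ _ _ _ _ _ f 0
  (dist_rot1 (dist_id A)) (dist_rot1 D).
  by rewrite vf comp0r.
have [g ->] := shift_full h; rewrite fmap_id compNr compNl comp_idr => /oppr_inj.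
by rewrite -fmap_comp => /shift_inj ->; exists g.
Qed.

Lemma dist_lift_w X Y Z (u : hom X Y) (v : hom Y Z) w A (f : hom A Z) :
  dist T (Tri u v w) -> w ∘ f = 0 -> exists g, f = v ∘ g.
Proof. by move/dist_rot1/dist_lift_v; apply. Qed.

Lemma dist_lift_u X Y Z (u : hom X Y) (v : hom Y Z) w A (f : hom A (X⟦1⟧)) :
  dist T (Tri u v w) -> u⟪1⟫ ∘ f = 0 -> exists g, f = w ∘ g.
Proof. by move/dist_rot2/dist_lift_v => L E; apply: L; rewrite compNl E oppr0. Qed.

Lemma dist_ext_u X Y Z (u : hom X Y) (v : hom Y Z) w A (f : hom Y A) :
  dist T (Tri u v w) -> f ∘ u = 0 -> exists g, f = g ∘ v.
Proof.
move=> D fu.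
have [|h [E _]] := @dist_fill _ _ _ _ _ _ _ _ _ _ _ _ 0 f D (dist_id_zob A).
  by rewrite fu comp0l.
by exists h; rewrite E comp_idl.
Qed.

Lemma dist_ext_v X Y Z (u : hom X Y) (v : hom Y Z) w A (f : hom Z A) :
  dist T (Tri u v w) -> f ∘ v = 0 -> exists g, f = g ∘ w.
Proof. by move/dist_rot1/dist_ext_u; apply. Qed.

Lemma dist_ext_w X Y Z (u : hom X Y) (v : hom Y Z) w A (f : hom X A) :
  dist T (Tri u v w) -> f⟪1⟫ ∘ w = 0 -> exists g, f = g ∘ u.
Proof.
move/dist_rot2/dist_ext_u => L /L [g]; have [k ->] := shift_full g => E.
by exists (- k); apply: shift_inj; rewrite E compNr compNl shiftN fmap_comp.
Qed.

(** The five lemma written out: [s0] is a right inverse of [h] up to a map through [v'], [t0] a left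
    inverse up to a map through [w], and invertibility of [g] and [f] lets both errors be
    corrected. *)
Lemma dist_mor_iso X Y Z X' Y' Z' (u : hom X Y) (v : hom Y Z) (w : hom Z (X⟦1⟧))
    (u' : hom X' Y') (v' : hom Y' Z') (w' : hom Z' (X'⟦1⟧)) f g h :
  dist T (Tri u v w) -> dist T (Tri u' v' w') ->
  g ∘ u = u' ∘ f -> h ∘ v = v' ∘ g -> f⟪1⟫ ∘ w = w' ∘ h -> is_iso f -> is_iso g ->
  is_iso h.
Proof.
move=> D D' E1 E2 E3 [f' [f'f ff']] [g' [g'g gg']].
have E1' : g' ∘ u' = u ∘ f'.
  by rewrite -[u']comp_idr -ff' (compA u') -E1 !compA g'g comp_idl.
have [s0 Es] : exists s0, f'⟪1⟫ ∘ w' = w ∘ s0.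
  apply: (dist_lift_u D).
  by rewrite compA -fmap_comp -E1' fmap_comp -compA (dist_comp_uw D') comp0r.
have [y Ey] : exists y, idm Z' - h ∘ s0 = v' ∘ y.
  apply: (dist_lift_w D'); rewrite compBr comp_idr (compA w') -E3 -compA -Es.
  by rewrite compA -fmap_comp ff' fmap_id comp_idl subrr.
have [t0 Et] : exists t0, v ∘ g' = t0 ∘ v'.
  by apply: (dist_ext_u D'); rewrite -compA E1' compA (dist_comp_vu D) comp0l.
have [x Ex] : exists x, idm Z - t0 ∘ h = x ∘ w.
  apply: (dist_ext_v D).
  by rewrite compBl comp_idl -compA E2 compA -Et -compA g'g comp_idr subrr.
have R : h ∘ (s0 + v ∘ g' ∘ y) = idm Z'.
  rewrite compDr !compA E2 -(compA v') gg' comp_idr -Ey addrC subrK //.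
have L : (t0 + x ∘ f'⟪1⟫ ∘ w') ∘ h = idm Z.
  rewrite compDl -!compA -E3 (compA _ f⟪1⟫) -fmap_comp f'f fmap_id comp_idl.
  by rewrite -Ex addrC subrK.
exists (s0 + v ∘ g' ∘ y); split=> //.
by rewrite -L; congr (_ ∘ h); rewrite -[LHS]comp_idl -L -compA R comp_idr.
Qed.

Lemma cone_unique X Y Z Z' (u : hom X Y) v w v' w' :
  dist T (@Tri T X Y Z u v w) -> dist T (@Tri T X Y Z' u v' w') ->
  exists2 h : hom Z Z', is_iso h & h ∘ v = v' /\ w = w' ∘ h.
Proof.
move=> D D'; have E : idm Y ∘ u = u ∘ idm X by rewrite comp_idl comp_idr.
have [h [E1 E2]] := dist_fill D D' E.
exists h; first by apply: (dist_mor_iso D D' E E1 E2); apply: is_iso_idm.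
by rewrite E1 -E2 fmap_id comp_idl comp_idr.
Qed.

(** Rotate the cone of [w] backwards, after replacing it by an isomorphic suspension. *)
Lemma dist_realize X Z (w : hom Z (X⟦1⟧)) :
  exists Y (u : hom X Y) (v : hom Y Z), dist T (Tri u v w).
Proof.
have [Q [a [b D]]] := dist_ex w; have [Y [f [g [gf fg]]]] := shift_ess Q.
have [u Eu] := shift_full (- (f ∘ a)); have [v Ev] := shift_full (- (b ∘ g)).
exists Y, u, v; apply/dist_rot2; rewrite -Eu -Ev !opprK.
apply: (dist_iso D); exists (idm Z), (idm _), f; split.
- split=> //=; rewrite ?comp_idl ?comp_idr // fmap_id comp_idl.
  by rewrite -compA gf comp_idr.
- exact: is_iso_idm.
- exact: is_iso_idm.
- by exists g.
Qed.

Lemma dist_third_unique X Y Y' Z (u : hom X Y) v (u' : hom X Y') v' w :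
  dist T (@Tri T X Y Z u v w) -> dist T (@Tri T X Y' Z u' v' w) ->
  exists2 h : hom Y Y', is_iso h & h ∘ u = u' /\ v = v' ∘ h.
Proof.
move=> /dist_rot2 D /dist_rot2 D'; have [h ih []] := cone_unique D D'.
have [k Ek] := shift_full h; rewrite {}Ek in ih *.
rewrite compNr compNl -!fmap_comp => /oppr_inj/shift_inj e /oppr_inj/shift_inj e'.
by exists k => //; apply: eqv_fun_iso ih.
Qed.

Lemma fiber_unique X X' Y Z (u : hom X Y) (u' : hom X' Y) (v : hom Y Z) w w' :
  dist T (Tri u v w) -> dist T (Tri u' v w') ->
  exists2 h : hom X X', is_iso h & u = u' ∘ h /\ h⟪1⟫ ∘ w = w'.
Proof.
move=> /dist_rot1 D /dist_rot1 D'; have [h ih []] := cone_unique D D'.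
have [k Ek] := shift_full h; rewrite {}Ek in ih * => <-.
rewrite compNl -!fmap_comp => /oppr_inj/shift_inj e.
by exists k => //; apply: eqv_fun_iso ih.
Qed.

Lemma dist_unshift X Y Z (u : hom X Y) (v : hom Y Z) (w : hom Z (X⟦1⟧)) :
  dist T (Tri u⟪1⟫ v⟪1⟫ (- w⟪1⟫)) -> dist T (Tri u v w).
Proof.
move=> D; apply/dist_rot2/dist_rot; apply: (dist_iso D).
(* Three rotations put a sign on all three maps; negating the middle object removes two of them. *)
exists (idm _), (- idm _), (idm _); split=> /=.
- by split=> //=; rewrite ?fmap_id ?compNl ?compNr ?comp_idl ?comp_idr ?opprK.
- exact: is_iso_idm.
- exact/is_iso_opp/is_iso_idm.
- exact: is_iso_idm.
Qed.

Lemma dist_unrot X Y Z (v : hom Y Z) (w : hom Z (X⟦1⟧)) k :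
  dist T (Tri v w k) -> exists u : hom X Y, dist T (Tri u v w).
Proof.
have [u Eu] := shift_full (- k) => D; exists u; apply/dist_rot.
by rewrite /triangle_rot /= -Eu opprK.
Qed.

Lemma dist_unrot2 X Y Z (w : hom Z (X⟦1⟧)) (a : hom (X⟦1⟧) (Y⟦1⟧)) b :
  dist T (Tri w a b) -> exists (u : hom X Y) (v : hom Y Z), dist T (Tri u v w).
Proof.
by move=> /dist_unrot [v /dist_unrot [u D]]; exists u, v.
Qed.

Lemma dist_split_retr X Y Z (u : hom X Y) (v : hom Y Z) :
  dist T (Tri u v 0) -> exists r, r ∘ u = idm X.
Proof.
by move=> /(@dist_ext_w _ _ _ _ _ _ _ (idm X))[|r ->]; [exact: comp0r | exists r].
Qed.

Lemma dist_split_sect X Y Z (u : hom X Y) (v : hom Y Z) :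
  dist T (Tri u v 0) -> exists s, v ∘ s = idm Z.
Proof.
by move=> /(@dist_lift_w _ _ _ _ _ _ _ (idm Z))[|s ->]; [exact: comp0l | exists s].
Qed.

Lemma dist_retr_w0 X Y Z (u : hom X Y) (v : hom Y Z) w r :
  dist T (Tri u v w) -> r ∘ u = idm X -> w = 0.
Proof.
move=> /dist_comp_uw D ru; rewrite -[w]comp_idl -(fmap_id (shift T)) -ru fmap_comp.
by rewrite -compA D comp0r.
Qed.

Lemma dist_sect_w0 X Y Z (u : hom X Y) (v : hom Y Z) w s :
  dist T (Tri u v w) -> v ∘ s = idm Z -> w = 0.
Proof. by move=> /dist_comp_wv D vs; rewrite -[w]comp_idr -vs compA D comp0l. Qed.

(** The zero map is the third map of some triangle; that triangle splits, and a retraction and a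
    section identify its middle term with the biproduct. *)
Lemma dist_bip X Y : dist T (Tri (injl X Y) (prr X Y) 0).
Proof.
have [E [u [v D]]] := dist_realize (0 : hom Y (X⟦1⟧)).
have [r ru] := dist_split_retr D.
have vu := dist_comp_vu D.
have [s vs] := dist_split_sect D.
apply: (dist_iso D).
(* The retraction [r] need not vanish on [s]. The idempotent [d] projects along [s], and [r ∘ d] is
   a retraction that does. *)
have [d [Ed du vd ds]] :
    exists d, [/\ d + s ∘ v = idm E, d ∘ u = u, v ∘ d = 0 & d ∘ s = 0].
  exists (idm E - s ∘ v); split; first by rewrite subrK.
  - by rewrite compBl comp_idl -compA vu comp0r subr0.
  - by rewrite compBr comp_idr compA vs comp_idl subrr.
  - by rewrite compBl comp_idl -compA vs comp_idr subrr.
have urd : u ∘ r ∘ d = d.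
  by have [x ->] := dist_lift_v D vd; rewrite -compA (compA r) ru comp_idl.
exists (idm X), (injl X Y ∘ r ∘ d + injr X Y ∘ v), (idm Y).
split; [split|exact: is_iso_idm| |exact: is_iso_idm] => /=.
- by rewrite compDl -!compA du ru vu !comp0r addr0.
- by rewrite compDr !compA prr_injl prr_injr !comp0l add0r.
- by rewrite fmap_id !comp0l !comp0r.
exists (u ∘ prl X Y + s ∘ prr X Y); split.
  rewrite compDl !compDr !compA -!(compA _ (prl X Y)) -!(compA _ (prr X Y)).
  rewrite prl_injl prl_injr prr_injl prr_injr !comp0r !comp0l !comp_idr urd.
  by rewrite addr0 add0r.
rewrite compDl !compDr -!compA (compA d u) du (compA d s) ds (compA r) ru.
by rewrite (compA v) vu (compA v) vs !comp0l !comp0r !comp_idl addr0 add0r injl_prlD.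
Qed.

End Triangulated.

(** * Phantom maps *)

Section ProperClass.
Variables (T : triangulated) (xi : set (triangle T)) (hxi : proper_class xi).
Implicit Types X Y Z A K L : T.

Definition phantom_map X Z (w : hom Z (X⟦1⟧)) : Prop :=
  exists Y (u : hom X Y) (v : hom Y Z), xi (Tri u v w).

Lemma xi_dist X Y Z (u : hom X Y) (v : hom Y Z) w :
  xi (Tri u v w) -> dist T (Tri u v w).
Proof. exact: pc_dist. Qed.

Lemma xi_phantom X Y Z (u : hom X Y) (v : hom Y Z) w :
  xi (Tri u v w) -> phantom_map w.
Proof. by exists Y, u, v. Qed.

Lemma phantom_xi X Y Z (u : hom X Y) (v : hom Y Z) w :
  phantom_map w -> dist T (Tri u v w) -> xi (Tri u v w).
Proof.
move=> [Y' [u' [v' Xw]]] D.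
have [h ih [E E']] := dist_third_unique (xi_dist Xw) D.
apply: (pc_iso hxi Xw); exists (idm X), h, (idm Z).
split; [split=> /=|exact: is_iso_idm|exact: ih|exact: is_iso_idm].
- by rewrite comp_idr.
- by rewrite comp_idl.
- by rewrite fmap_id comp_idl comp_idr.
Qed.

Lemma phantom0 X Z : phantom_map (0 : hom Z (X⟦1⟧)).
Proof.
have [Y [u [v D]]] := dist_realize (0 : hom Z (X⟦1⟧)).
by exists Y, u, v; apply: pc_split.
Qed.

Lemma phantom_base X Z Z' (w : hom Z (X⟦1⟧)) (a : hom Z' Z) :
  phantom_map w -> phantom_map (w ∘ a).
Proof.
move=> [Y [u [v Xw]]]; have [Y' [u' [v' D]]] := dist_realize (w ∘ a).
by exists Y', u', v'; apply: (pc_base hxi Xw).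
Qed.

Lemma phantom_cobase X X' Z (w : hom Z (X⟦1⟧)) (b : hom X X') :
  phantom_map w -> phantom_map (b⟪1⟫ ∘ w).
Proof.
move=> [Y [u [v Xw]]]; have [Y' [u' [v' D]]] := dist_realize (b⟪1⟫ ∘ w).
by exists Y', u', v'; apply: (pc_cobase hxi Xw).
Qed.

Lemma phantomN X Z (w : hom Z (X⟦1⟧)) : phantom_map w -> phantom_map (- w).
Proof. by move/(phantom_base (- idm Z)); rewrite compNr comp_idr. Qed.

Lemma phantom_sat X Z K V (w : hom Z (X⟦1⟧)) (k : hom K V) (a : hom V Z) c :
  xi (Tri k a c) -> phantom_map (w ∘ a) -> phantom_map w.
Proof.
move=> Xa [Y' [u' [v' Xw]]]; have [Y [u [v D]]] := dist_realize w.
by exists Y, u, v; apply: (pc_sat hxi D Xa Xw).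
Qed.

(* Over the xi-proper epimorphism of the cobase change the map [w] factors     *)
(* through the phantom third map of [b], so saturation applies.               *)
Lemma phantom_cosat X X' C Z (w : hom Z (X⟦1⟧)) (b : hom X X') (p : hom X' C) c :
  xi (Tri b p c) -> phantom_map (b⟪1⟫ ∘ w) -> phantom_map w.
Proof.
move=> Xb [Y [u [v Xw]]].
have [|s Es] := dist_lift_u (f := w ∘ v) (xi_dist Xb).
  by rewrite compA (dist_comp_wv (xi_dist Xw)).
by apply: (phantom_sat Xw); rewrite Es; apply/phantom_base/(xi_phantom Xb).
Qed.

(** The third map [c'] is killed by [u⟪1⟫], hence by [(v ∘ u)⟪1⟫]; as zero is phantom, saturation
    along the proper monomorphism [v ∘ u] applies. *)
Lemma xi_mono_cancel X Y Z C C' (u : hom X Y) (v : hom Y Z) p c p' c' :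
  xi (@Tri T X Z C (v ∘ u) p c) -> dist T (@Tri T X Y C' u p' c') ->
  xi (Tri u p' c').
Proof.
move=> Xvu D; apply: (phantom_xi _ D); apply: (phantom_cosat Xvu).
rewrite fmap_comp -compA (dist_comp_uw D) comp0r; exact: phantom0.
Qed.

Lemma xi_epi_cancel X Y Z K K' (u : hom X Y) (v : hom Y Z) k c k' c' :
  xi (@Tri T K X Z k (v ∘ u) c) -> dist T (@Tri T K' Y Z k' v c') ->
  xi (Tri k' v c').
Proof.
move=> Xvu D; apply: (phantom_xi _ D); apply: (phantom_sat Xvu).
rewrite compA (dist_comp_wv D) comp0l; exact: phantom0.
Qed.

(** Octahedral axiom: [u⟪1⟫ ∘ f] factors through the phantom map [d], so [f] is phantom; the third
    map of the triangle of cones is a cobase change of [d]. *)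
Lemma xi_mono_comp X Y Z A B C (u : hom X Y) (v : hom Y Z) a b c d e f :
  xi (@Tri T X Y A u a b) -> xi (@Tri T Y Z B v c d) ->
  dist T (@Tri T X Z C (v ∘ u) e f) ->
  xi (Tri (v ∘ u) e f) /\
  exists (g : hom A C) (h : hom C B) k, xi (Tri g h k).
Proof.
move=> Xu Xv D.
have [g [h [Dg _ fg _ dh]]] := dist_oct (xi_dist Xu) (xi_dist Xv) D.
split.
  apply: (phantom_xi _ D); apply: (phantom_cosat Xu); rewrite -dh.
  exact/phantom_base/(xi_phantom Xv).
exists g, h, (a⟪1⟫ ∘ d); apply: (phantom_xi _ Dg).
exact/phantom_cobase/(xi_phantom Xv).
Qed.

(** Dual to [xi_mono_comp]. The octahedron is drawn on the rotated triangles, so the triangle of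
    kernels appears suspended and is then desuspended. *)
Lemma xi_epi_comp X Y Z K L M (p : hom X Y) (q : hom Y Z) k c l d r s :
  xi (@Tri T K X Y k p c) -> xi (@Tri T L Y Z l q d) ->
  dist T (@Tri T M X Z r (q ∘ p) s) ->
  xi (Tri r (q ∘ p) s) /\
  exists (g : hom K M) (h : hom M L) e, xi (Tri g h e).
Proof.
move=> Xp Xq D.
have [g [h [Dg gc _ _ _]]] := dist_oct (dist_rot1 (xi_dist Xp))
  (dist_rot1 (xi_dist Xq)) (dist_rot1 D).
have [g' Eg] := shift_full g; have [h' Eh] := shift_full h.
rewrite {}Eg {}Eh in Dg gc; split.
  apply: (phantom_xi _ D); apply: (phantom_sat Xq); rewrite -gc.
  exact/phantom_cobase/(xi_phantom Xp).
exists g', h', (c ∘ l); apply: phantom_xi; last first.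
  by apply: dist_unshift; rewrite fmap_comp; rewrite compNr in Dg.
exact/phantom_base/(xi_phantom Xp).
Qed.

(** In the octahedron the connecting map A -> L[1] becomes [- b] after composition with [l⟪1⟫], up
    to the sign convention, so it is phantom by saturation. *)
Lemma xi_ker_cone X Y Z A K L (t : hom X Y) (p : hom Y Z) a b k c l d :
  xi (@Tri T X Y A t a b) -> xi (@Tri T K Y Z k p c) ->
  xi (@Tri T L X Z l (p ∘ t) d) ->
  exists (x : hom L K) (y : hom K A) e, xi (Tri x y e).
Proof.
move=> Xt Xp Xpt.
have [g [h [Dg _ fg _ _]]] := dist_oct (xi_dist Xt)
  (dist_rot1 (xi_dist Xp)) (dist_rot1 (xi_dist Xpt)).
have [x [y D]] := dist_unrot2 Dg; exists x, y, g; apply: (phantom_xi _ D).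
apply: (phantom_cosat Xpt); rewrite -[_ ∘ g]opprK -compNl fg.
exact/phantomN/(xi_phantom Xt).
Qed.

(** Here the composite is a proper monomorphism; the connecting map C -> K[1] restricts to the
    phantom map [c] along the proper epimorphism [e]. *)
Lemma xi_ker_cones X Y Z A C K (t : hom X Y) (p : hom Y Z) a b k c e f :
  xi (@Tri T X Y A t a b) -> xi (@Tri T K Y Z k p c) ->
  xi (@Tri T X Z C (p ∘ t) e f) ->
  exists (x : hom K A) (y : hom A C) z, xi (Tri x y z).
Proof.
move=> Xt Xp Xpt.
have [g [h [Dg _ _ he _]]] := dist_oct (xi_dist Xt)
  (dist_rot1 (xi_dist Xp)) (xi_dist Xpt).
have [x D] := dist_unrot Dg; exists x, g, h; apply: (phantom_xi _ D).
by apply: (phantom_sat Xpt); rewrite he; apply: (xi_phantom Xp).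
Qed.

(** Homotopy pullback of [q] and [m]: its suspension is the cone of [e ∘ q], and the octahedron on
    this composite supplies the other triangle and the compatibilities. *)
Lemma dist_pullback K V Z L Y (k : hom K V) (q : hom V Z) (c : hom Z (K⟦1⟧))
    (l : hom L Y) (m : hom Y Z) (e : hom Z (L⟦1⟧)) :
  dist T (Tri k q c) -> dist T (Tri l m e) ->
  exists P (k' : hom K P) (p : hom P Y) (l' : hom L P) (n : hom P V),
    [/\ dist T (Tri k' p (c ∘ m)), dist T (Tri l' n (e ∘ q)), m ∘ p = q ∘ n,
        n ∘ k' = k & p ∘ l' = l].
Proof.
move=> Dq Dm; have [P [l' [n Dn]]] := dist_realize (e ∘ q).
have [g [h [Dg _ fg he dh]]] := dist_oct (dist_rot1 Dq)
  ((dist_rot2 _ _ _).1 Dm) ((dist_rot2 _ _ _).1 Dn).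
have [k' Eg] := shift_full g; have [p Eh] := shift_full h.
rewrite {}Eg {}Eh in Dg fg he dh; exists P, k', p, l', n; split=> //.
- by apply: dist_unshift; rewrite fmap_comp; rewrite compNr in Dg.
- by apply: shift_inj; move: dh; rewrite compNl compNr -!fmap_comp => /oppr_inj.
- by apply: shift_inj; move: fg; rewrite compNl -!fmap_comp => /oppr_inj.
- by apply: shift_inj; move: he; rewrite compNr -!fmap_comp => /oppr_inj.
Qed.

(** Lift [a] to [t0]; the discrepancy [n ∘ t0 - b] is killed by [q], so it comes from [K] and can be
    subtracted. The lift is not claimed to be unique. *)
Lemma weak_pullback K V Z Y P (k : hom K V) (q : hom V Z) (c : hom Z (K⟦1⟧))
    (m : hom Y Z) (k' : hom K P) (p : hom P Y) (n : hom P V) :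
  dist T (Tri k q c) -> dist T (Tri k' p (c ∘ m)) -> m ∘ p = q ∘ n -> n ∘ k' = k ->
  forall A (a : hom A Y) (b : hom A V), m ∘ a = q ∘ b ->
  exists t, p ∘ t = a /\ n ∘ t = b.
Proof.
move=> Dq Dp E Ek A a b Eab.
have [|t0 Et0] := dist_lift_w (f := a) Dp.
  by rewrite -compA Eab compA (dist_comp_wv Dq) comp0l.
have [|x Ex] := dist_lift_v (f := n ∘ t0 - b) Dq.
  by rewrite compBr compA -E -compA -Et0 Eab subrr.
exists (t0 - k' ∘ x); split.
  by rewrite compBr compA (dist_comp_vu Dp) comp0l subr0.
by rewrite compBr compA Ek -Ex subKr.
Qed.

End ProperClass.

Lemma dist_fill_fst (T : triangulated) (X Y Z X' Y' Z' : T)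
    (u : hom X Y) (v : hom Y Z) (w : hom Z (X⟦1⟧))
    (u' : hom X' Y') (v' : hom Y' Z') (w' : hom Z' (X'⟦1⟧)) g h :
  dist T (Tri u v w) -> dist T (Tri u' v' w') -> h ∘ v = v' ∘ g ->
  exists f, g ∘ u = u' ∘ f /\ f⟪1⟫ ∘ w = w' ∘ h.
Proof.
move=> /dist_rot1 D /dist_rot1 D' E; have [k] := dist_fill D D' E; have [f ->] := shift_full k => -[Ek].
by rewrite compNr compNl -!fmap_comp => /oppr_inj/shift_inj; exists f.
Qed.

(** * Cotorsion pairs *)

Section Classes.
Variables (T : triangulated) (xi : set (triangle T)) (hxi : proper_class xi).
Implicit Types X Y Z K L C : T.
Implicit Types A B : set T.

(** The definition takes the [xi]-triangle and the hocokernel in the class separately; uniqueness of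
    cones puts them into one triangle. *)
Lemma mono_inP A X Y (u : hom X Y) :
  mono_in xi A u <-> exists Z v w, xi (@Tri T X Y Z u v w) /\ A Z.
Proof.
split=> [[[Z' [v' [w' Xu]]] [Z [v [w D]] AZ]]|[Z [v [w [Xu AZ]]]]].
  exists Z, v, w; split=> //.
  have [h _ [_ Ew]] := cone_unique D (xi_dist hxi Xu).
  by apply: (phantom_xi hxi _ D); rewrite Ew; apply/phantom_base/(xi_phantom Xu).
split; first by exists Z, v, w.
by exists Z => //; exists v, w; apply: xi_dist Xu.
Qed.

Lemma epi_inP A X Y (p : hom X Y) :
  epi_in xi A p <-> exists K k c, xi (@Tri T K X Y k p c) /\ A K.
Proof.
split=> [[[Z [a [c' Xp]]] [K [k [c D]] AK]]|[K [k [c [Xp AK]]]]].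
  exists K, k, c; split=> //.
  have [h _ [_ Ec]] := fiber_unique (xi_dist hxi Xp) D.
  by apply: (phantom_xi hxi _ D); rewrite -Ec; apply/phantom_cobase/(xi_phantom Xp).
split; last by exists K => //; exists k, c; apply: xi_dist Xp.
(* A proper epimorphism has a first term of the form Z[-1], so [K] is moved to K[1][-1] by the unit;
   the counit in the third map cancels against [counit_inv]. *)
exists (K⟦1⟧), (k ∘ unit_inv K),
  (nt (eqv_counit (susp T)) (K⟦1⟧) ∘ (nt (eqv_unit (susp T)) K)⟪1⟫ ∘ c).
apply: (pc_iso hxi Xp); exists (nt (eqv_unit (susp T)) K), (idm X), (idm Y).
split.
- split=> /=; rewrite ?comp_idl ?comp_idr //.
  + rewrite -compA; have /= -> := nt_invl (eqv_unit (susp T)) K.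
    by rewrite comp_idr.
  + rewrite !compA; have /= -> := nt_invl (eqv_counit (susp T)) (K⟦1⟧).
    by rewrite comp_idl.
- exists (unit_inv K); split.
    by have := nt_invl (eqv_unit (susp T)) K.
  by have := nt_invr (eqv_unit (susp T)) K.
- exact: is_iso_idm.
- exact: is_iso_idm.
Qed.

Lemma Ext_phantom X Y (w : hom X (Y⟦1⟧)) :
  Ext_zero xi X Y -> phantom_map xi w -> w = 0.
Proof. by move=> E [Z [u [v /E]]]. Qed.

Lemma Ext_extend X Y C K (i : hom X Y) a b (f : hom X K) :
  xi (@Tri T X Y C i a b) -> Ext_zero xi C K -> exists g, f = g ∘ i.
Proof.
move=> Xi E; apply: (dist_ext_w (xi_dist hxi Xi)); apply: (Ext_phantom E).
exact/phantom_cobase/(xi_phantom Xi).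
Qed.

Lemma Ext_lift X Y K C (k : hom K X) (p : hom X Y) c (f : hom C Y) :
  xi (Tri k p c) -> Ext_zero xi C K -> exists g, f = p ∘ g.
Proof.
move=> Xp E; apply: (dist_lift_w (xi_dist hxi Xp)); apply: (Ext_phantom E).
exact/phantom_base/(xi_phantom Xp).
Qed.

(** Two obstructions, both in Ext_xi(C, K). The first, [e], is that of lifting [g] through [p]; it
    is phantom by saturation. The second is that of extending along [i] the error [x] of the
    resulting lift on [X]. *)
Lemma lifts_Ext X Y C K X' Y' (i : hom X Y) a b (k : hom K X') (p : hom X' Y') c :
  xi (@Tri T X Y C i a b) -> xi (Tri k p c) -> Ext_zero xi C K -> lifts i p.
Proof.
move=> Xi Xp E f g Efg.
have [|e Ee] := dist_ext_u (f := c ∘ g) (xi_dist hxi Xi).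
  by rewrite -compA -Efg compA (dist_comp_wv (xi_dist hxi Xp)) comp0l.
have e0 : e = 0.
  apply: (Ext_phantom E); apply: (phantom_sat hxi Xi); rewrite -Ee.
  exact/phantom_base/(xi_phantom Xp).
have [|h0 Eg] := dist_lift_w (f := g) (xi_dist hxi Xp).
  by rewrite Ee e0 comp0l.
have [|x Ex] := dist_lift_v (f := h0 ∘ i - f) (xi_dist hxi Xp).
  by rewrite compBr compA -Eg Efg subrr.
have [y Ey] := Ext_extend x Xi E.
exists (h0 - k ∘ y); rewrite compBl compBr -compA -Ey -Ex subKr; split=> //.
by rewrite compA (dist_comp_vu (xi_dist hxi Xp)) comp0l subr0.
Qed.

Lemma Ext_retractl X X' Y (s : hom X' X) (r : hom X X') :
  r ∘ s = idm X' -> Ext_zero xi X Y -> Ext_zero xi X' Y.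
Proof.
move=> rs E Z u v w Xw; rewrite -[w]comp_idr -rs compA.
by rewrite (Ext_phantom (w := w ∘ r) E) ?comp0l //; apply/phantom_base/(xi_phantom Xw).
Qed.

Lemma Ext_retractr X Y Y' (s : hom Y' Y) (r : hom Y Y') :
  r ∘ s = idm Y' -> Ext_zero xi X Y -> Ext_zero xi X Y'.
Proof.
move=> rs E Z u v w Xw.
rewrite -[w]comp_idl -(fmap_id (shift T)) -rs fmap_comp -compA.
by rewrite (Ext_phantom (w := s⟪1⟫ ∘ w) E) ?comp0r //; apply/phantom_cobase/(xi_phantom Xw).
Qed.

(** A phantom map on [Y] vanishes on [X], so it factors through [Z], and saturation makes the factor
    phantom. *)
Lemma Ext_extl X Y Z K (u : hom X Y) (v : hom Y Z) w :
  xi (Tri u v w) -> Ext_zero xi X K -> Ext_zero xi Z K -> Ext_zero xi Y K.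
Proof.
move=> Xt EX EZ W a b c Xc.
have [|e Ee] := dist_ext_u (f := c) (xi_dist hxi Xt).
  by apply: (Ext_phantom EX); apply/phantom_base/(xi_phantom Xc).
rewrite Ee (Ext_phantom (w := e) EZ) ?comp0l //; apply: (phantom_sat hxi Xt).
by rewrite -Ee; apply: (xi_phantom Xc).
Qed.

Lemma Ext_extr X Y Z C (u : hom X Y) (v : hom Y Z) w :
  xi (Tri u v w) -> Ext_zero xi C X -> Ext_zero xi C Z -> Ext_zero xi C Y.
Proof.
move=> Xt EX EZ W a b c Xc.
have [|e Ee] := dist_lift_u (f := c) (dist_rot1 (xi_dist hxi Xt)).
  by apply: (Ext_phantom EZ); apply/phantom_cobase/(xi_phantom Xc).
rewrite Ee compNl -compNr (Ext_phantom (w := - e) EX) ?comp0r //.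
apply: (phantom_cosat hxi Xt).
by rewrite compNr -compNl -Ee; apply: (xi_phantom Xc).
Qed.

Definition retract_closed_ob A : Prop :=
  forall X X' (s : hom X' X) (r : hom X X'), r ∘ s = idm X' -> A X -> A X'.

Definition extension_closed A : Prop :=
  forall X Y Z (u : hom X Y) (v : hom Y Z) w, xi (Tri u v w) -> A X -> A Z -> A Y.

Section Cotorsion.
Variables (A B : set T) (hAB : cotorsion_pair xi A B).

Lemma cotorsion_Ext X Y : A X -> B Y -> Ext_zero xi X Y.
Proof. by case: hAB => -> _ AX; apply. Qed.

Lemma cotorsion_retractl : retract_closed_ob A.
Proof.
move=> X X' s r rs AX; case: hAB => _ -> Y BY.
exact: Ext_retractl rs (cotorsion_Ext AX BY).
Qed.

Lemma cotorsion_retractr : retract_closed_ob B.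
Proof.
move=> Y Y' s r rs BY; case: hAB => -> _ X AX.
exact: Ext_retractr rs (cotorsion_Ext AX BY).
Qed.

Lemma cotorsion_extl : extension_closed A.
Proof.
move=> X Y Z u v w Xt AX AZ; case: hAB => _ -> K BK.
exact: Ext_extl Xt (cotorsion_Ext AX BK) (cotorsion_Ext AZ BK).
Qed.

Lemma cotorsion_extr : extension_closed B.
Proof.
move=> X Y Z u v w Xt BX BZ; case: hAB => -> _ K AK.
exact: Ext_extr Xt (cotorsion_Ext AK BX) (cotorsion_Ext AK BZ).
Qed.

Lemma cotorsion_zobl : A zob.
Proof.
by case: hAB => _ -> Y _ E u v w _; apply: hom_from_zob.
Qed.

Lemma cotorsion_zobr : B zob.
Proof.
case: hAB => -> _ X _ E u v w _.
by rewrite -[w]comp_idl shift_zob comp0l.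
Qed.

End Cotorsion.

Lemma retract_closed_iso A X Y (f : hom X Y) :
  retract_closed_ob A -> is_iso f -> A X -> A Y.
Proof. by move=> RA [g [_ fg]]; apply: RA fg. Qed.

Lemma xi_cone_unique A X Y Z Z' (u : hom X Y) v w v' w' : retract_closed_ob A ->
  dist T (@Tri T X Y Z u v w) -> dist T (@Tri T X Y Z' u v' w') -> A Z -> A Z'.
Proof. by move=> RA D D'; have [h ih _] := cone_unique D D'; apply: retract_closed_iso ih. Qed.

Lemma xi_fiber_unique A X X' Y Z (u : hom X Y) (u' : hom X' Y) (v : hom Y Z) w w' :
  retract_closed_ob A ->
  dist T (Tri u v w) -> dist T (Tri u' v w') -> A X -> A X'.
Proof. by move=> RA D D'; have [h ih _] := fiber_unique D D'; apply: retract_closed_iso ih. Qed.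

Lemma dist_ex_fiber X Y (p : hom X Y) :
  exists K (k : hom K X) c, dist T (Tri k p c).
Proof.
have [C [v [w D]]] := dist_ex p; have [K [f [g [gf fg]]]] := shift_ess C.
have [|k Dk] := @dist_unrot T K X Y p (f ∘ v) (w ∘ g); last by exists K, k, (f ∘ v).
apply: (dist_iso D); exists (idm X), (idm Y), f.
split; [split=> /=|exact: is_iso_idm|exact: is_iso_idm|by exists g].
- by rewrite comp_idl comp_idr.
- by rewrite comp_idr.
- by rewrite -compA gf fmap_id comp_idl comp_idr.
Qed.

Lemma epi_in_comp A X Y Z (p : hom X Y) (q : hom Y Z) :
  extension_closed A -> epi_in xi A p -> epi_in xi A q -> epi_in xi A (q ∘ p).
Proof.
move=> EA /epi_inP [K [k [c [Xp AK]]]] /epi_inP [L [l [d [Xq AL]]]].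
have [M [m [e D]]] := dist_ex_fiber (q ∘ p); apply/epi_inP.
have [Xqp [g [h [f Xg]]]] := xi_epi_comp hxi Xp Xq D.
by exists M, m, e; split=> //; apply: EA Xg AK AL.
Qed.

Lemma xi_split_mono X Y (s : hom X Y) r : r ∘ s = idm X ->
  exists Z v, xi (@Tri T X Y Z s v 0).
Proof.
move=> rs; have [Z [v [w D]]] := dist_ex s; exists Z, v.
have w0 := dist_retr_w0 D rs; rewrite w0 in D.
exact: pc_split hxi _ D erefl.
Qed.

Lemma xi_split_epi X Y (s : hom X Y) r : r ∘ s = idm X ->
  exists Z k, xi (@Tri T Z Y X k r 0).
Proof.
move=> rs; have [Z [k [c D]]] := dist_ex_fiber r; exists Z, k.
have c0 := dist_sect_w0 D rs; rewrite c0 in D.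
exact: pc_split hxi _ D erefl.
Qed.

(** [j ∘ f] equals [g ∘ i], a composite of proper monomorphisms, so [f] is proper by cancellation.
    The maps [a] and [b] between cones are not functorial, but [b ∘ a] is an isomorphism, which
    suffices for a retract. *)
Lemma mono_in_retract A : retract_closed_ob A -> retract_closed (mono_in xi A).
Proof.
move=> RA X Y X' Y' f g [i [r [j [s [ri sj gi fr]]]]] /mono_inP [C' [v' [w' [Xg AC']]]].
have [C [v [w Df]]] := dist_ex f; apply/mono_inP; exists C, v, w.
have [Z [p Xi]] := xi_split_mono ri.
have [M [e [d De]]] := dist_ex (g ∘ i).
have [Xgi _] := xi_mono_comp hxi Xi Xg De.
split; first by rewrite gi in Xgi; apply: xi_mono_cancel Xgi Df.
have [a [Ea Ea']] := dist_fill Df (xi_dist hxi Xg) (esym gi).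
have [b [Eb Eb']] := dist_fill (xi_dist hxi Xg) Df (esym fr).
have [t [tba _]] : is_iso (b ∘ a).
  apply: (dist_mor_iso Df Df (f := idm X) (g := idm Y)); try exact: is_iso_idm.
  - by rewrite comp_idl comp_idr.
  - by rewrite -compA Ea compA Eb -compA sj comp_idr.
  - by rewrite compA -Eb' -compA -Ea' compA -fmap_comp ri.
by rewrite compA in tba; apply: RA tba AC'.
Qed.

(** Dual argument with [f ∘ r] and the split epimorphism [s]. *)
Lemma epi_in_retract A : retract_closed_ob A -> retract_closed (epi_in xi A).
Proof.
move=> RA X Y X' Y' f g [i [r [j [s [ri sj gi fr]]]]] /epi_inP [K' [k' [c' [Xg AK']]]].
have [K [k [c Df]]] := dist_ex_fiber f; apply/epi_inP; exists K, k, c.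
have [Z [p Xs]] := xi_split_epi sj.
have [M [e [d De]]] := dist_ex_fiber (s ∘ g).
have [Xsg _] := xi_epi_comp hxi Xg Xs De.
split; first by rewrite -fr in Xsg; apply: xi_epi_cancel Xsg Df.
have [a [Ea Ea']] := dist_fill_fst Df (xi_dist hxi Xg) (esym gi).
have [b [Eb Eb']] := dist_fill_fst (xi_dist hxi Xg) Df (esym fr).
have /eqv_fun_iso [t [tba _]] : is_iso (b ∘ a)⟪1⟫.
  apply: (dist_mor_iso (dist_rot1 Df) (dist_rot1 Df) (f := idm X) (g := idm Y));
    try exact: is_iso_idm.
  - by rewrite comp_idl comp_idr.
  - by rewrite fmap_comp -compA Ea' compA Eb' -compA sj comp_idr.
  - rewrite fmap_id comp_idl compNl -fmap_comp compA -Eb -compA -Ea compA ri.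
    by rewrite comp_idl.
by rewrite compA in tba; apply: RA tba AK'.
Qed.

Lemma cotorsion_factor A B X Y (f : hom X Y) :
  cotorsion_pair xi A B -> complete_pair xi A B ->
  exists Z (i : hom X Z) (p : hom Z Y),
    [/\ mono_in xi A i, epi_in xi B p & f = p ∘ i].
Proof.
move=> hAB hc.
have [_ [A0 [B0 [u [v [w [Xu AA0 BB0]]]]]]] := hc X.
(* Adding the component [u] makes [f] a proper monomorphism, by cancellation, at the price of a
   kernel [B0] when projecting back to [Y]. *)
pose j : hom X (bip B0 Y) := injl B0 Y ∘ u + injr B0 Y ∘ f.
have ju : prl B0 Y ∘ j = u.
  by rewrite compDr !compA prl_injl prl_injr comp0l comp_idl addr0.
have jf : prr B0 Y ∘ j = f.
  by rewrite compDr !compA prr_injl prr_injr comp0l comp_idl add0r.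
have [C [a [b Dj]]] := dist_ex j.
have Xj : xi (Tri j a b) by rewrite -ju in Xu; apply: xi_mono_cancel Xu Dj.
have [[A1 [B1 [k [q [c [Xq AA1 BB1]]]]]] _] := hc C.
(* Base change makes the cone of X -> P equal to [A1] and the kernel of P -> B0 + Y equal to [B1];
   the kernel of P -> Y is then an extension of [B0] by [B1]. *)
have [P [k' [p [l' [n [Dp Dn E Ek El]]]]]] :=
  dist_pullback (xi_dist hxi Xq) (xi_dist hxi Xj).
exists P, l', (prr B0 Y ∘ p); split; last by rewrite -compA El jf.
  apply/mono_inP; exists A1, n, (b ∘ q); split=> //.
  apply: (phantom_xi hxi _ Dn); exact/phantom_base/(xi_phantom Xj).
apply: (epi_in_comp (cotorsion_extr hAB)).
  apply/epi_inP; exists B1, k', (c ∘ a); split=> //.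
  apply: (phantom_xi hxi _ Dp); exact/phantom_base/(xi_phantom Xq).
apply/epi_inP; exists B0, (injl B0 Y), 0; split=> //.
exact: pc_split hxi _ (dist_bip B0 Y) erefl.
Qed.

End Classes.

(** * Thick classes and comparison of cones *)

Section Thick.
Variables (T : triangulated) (xi : set (triangle T)) (hxi : proper_class xi).
Variables (W : set T) (tW : thick xi W).
Implicit Types X Y Z K L C : T.

(** The splitting triangle on [s] turns the retract into a direct summand. *)
Lemma thick_retract : retract_closed_ob W.
Proof.
move=> X X' s r rs WX; case: tW => Wiso Wsum _.
have [Z [v /xi_dist D]] := xi_split_mono hxi rs.
have [h ih _] := dist_third_unique (D hxi) (dist_bip X' Z).
by have [] := Wsum _ _ (Wiso _ _ _ ih WX).
Qed.

Lemma thick_iff_cone X Y Z Z' (u : hom X Y) v w v' w' :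
  dist T (@Tri T X Y Z u v w) -> dist T (@Tri T X Y Z' u v' w') -> (W Z <-> W Z').
Proof.
by move=> D D'; split; apply: xi_cone_unique; eauto; apply: thick_retract.
Qed.

Section Triangle.
Variables (X Y Z : T) (u : hom X Y) (v : hom Y Z) (w : hom Z (X⟦1⟧)).
Hypothesis Xt : xi (Tri u v w).

Lemma thick_cone : W X -> W Y -> W Z.
Proof. by case: tW => _ _ /(_ _ Xt) []. Qed.

Lemma thick_mid : W X -> W Z -> W Y.
Proof. by case: tW => _ _ /(_ _ Xt) []. Qed.

Lemma thick_fiber : W Y -> W Z -> W X.
Proof. by case: tW => _ _ /(_ _ Xt) []. Qed.

End Triangle.

(** Both factorizations are dominated by a map [t] from [X] to the pullback of [p] and [p']. Its
    cone [A] lies in triangles K' -> A -> C and K -> A -> C', which transfer membership from [C] to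
    [A] to [C']. *)
Lemma thick_factor_cone X Y V V' K K' C C' (i : hom X V) a b (k : hom K V) p c
    (i' : hom X V') a' b' (k' : hom K' V') p' c' :
  xi (@Tri T X V C i a b) -> xi (@Tri T K V Y k p c) ->
  xi (@Tri T X V' C' i' a' b') -> xi (@Tri T K' V' Y k' p' c') ->
  p ∘ i = p' ∘ i' -> W K -> W K' -> W C -> W C'.
Proof.
move=> Xi Xp Xi' Xp' E WK WK' WC.
have [P [m [n' [m' [n [Dn' Dn En Em Em']]]]]] :=
  dist_pullback (xi_dist hxi Xp) (xi_dist hxi Xp').
have [t [Et' Et]] := weak_pullback (xi_dist hxi Xp) Dn' En Em (esym E).
have [A [e [d Dt]]] := dist_ex t.
have Xt : xi (Tri t e d) by rewrite -Et in Xi; apply: xi_mono_cancel Xi Dt.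
have Xn' := phantom_xi hxi (phantom_base hxi _ (xi_phantom Xp)) Dn'.
have Xn := phantom_xi hxi (phantom_base hxi _ (xi_phantom Xp')) Dn.
rewrite -Et in Xi; rewrite -Et' in Xi'.
have [? [? [? S]]] := xi_ker_cones hxi Xt Xn Xi.
have [? [? [? S']]] := xi_ker_cones hxi Xt Xn' Xi'.
by apply: (thick_cone S') => //; apply: (thick_mid S).
Qed.

(** Compare [U] with the pullback [P] of [q] along [j] by [t]. The cone [A] of [t] is in [W] by the
    triangle K -> K' -> A, and A -> C' -> L[1] then compares [C'] with a cone of [j]. *)
Lemma thick_square_cone U Y S V K K' C C' (p : hom U Y) (q : hom S V)
    (j : hom Y V) (j' : hom U S) k c k' c' a b a' b' :
  xi (@Tri T K U Y k p c) -> xi (@Tri T K' S V k' q c') ->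
  xi (@Tri T Y V C j a b) -> xi (@Tri T U S C' j' a' b') ->
  j ∘ p = q ∘ j' -> W K -> W K' -> (W C <-> W C').
Proof.
move=> Xp Xq Xj Xj' E WK WK'.
(* The pullback is phrased with fibers, so the cone of [j] is represented as L[1]. *)
have [L [l [e De]]] := dist_ex_fiber j.
have [P [m [r [m' [n [Dr Dn En Em Em']]]]]] := dist_pullback (xi_dist hxi Xq) De.
have [t [Et' Et]] := weak_pullback (xi_dist hxi Xq) Dr En Em E.
have Xe : xi (Tri j e (- l⟪1⟫)).
  by rewrite -[j]comp_idl in Xj; apply: xi_mono_cancel Xj (dist_rot1 De).
have WCL := thick_iff_cone (xi_dist hxi Xj) (xi_dist hxi Xe).
have [Xn _] := xi_epi_comp hxi Xq Xe (dist_rot1 Dn).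
have [A [f [d Dt]]] := dist_ex t.
have Xt : xi (Tri t f d) by rewrite -Et in Xj'; apply: xi_mono_cancel Xj' Dt.
have Xr := phantom_xi hxi (phantom_base hxi _ (xi_phantom Xq)) Dr.
rewrite -Et' in Xp; rewrite -Et in Xj'.
have [? [? [? XA]]] := xi_ker_cone hxi Xt Xr Xp.
have WA : W A := thick_cone XA WK WK'.
have [_ [? [? [? S']]]] := xi_mono_comp hxi Xt Xn (xi_dist hxi Xj').
rewrite WCL; split=> [WL|WC']; first exact: (thick_mid S').
exact: (thick_cone S').
Qed.

End Thick.

(** * From Hovey triples to model structures *)

Section ModelOfHovey.
Variables (T : triangulated) (xi : set (triangle T)) (hxi : proper_class xi).
Variables (H : ob_triple T) (hH : hovey_triple xi H).
Implicit Types X Y Z K L : T.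
Notation C := (obC H).
Notation F := (obF H).
Notation W := (obW H).
Notation M := (model_of_hovey xi H).

Let tW : thick xi W. Proof. by case: hH. Qed.
Let cotC : cotorsion_pair xi C (F `&` W). Proof. by case: hH => _ []. Qed.
Let cotF : cotorsion_pair xi (C `&` W) F. Proof. by case: hH => _ _ []. Qed.
Let cplC : complete_pair xi C (F `&` W). Proof. by case: hH => _ []. Qed.
Let cplF : complete_pair xi (C `&` W) F. Proof. by case: hH => _ _ []. Qed.

Lemma mono_in_iso (A : set T) X Y (f : hom X Y) :
  A zob -> is_iso f -> mono_in xi A f.
Proof.
move=> A0 fi; apply/(mono_inP hxi); exists zob, 0, 0; split=> //.
apply: (pc_split hxi) => //; apply: (dist_iso (dist_id X)).
exists (idm X), f, (idm zob).
split; [split=> /=|exact: is_iso_idm|exact: fi|exact: is_iso_idm].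
- by rewrite !comp_idr.
- by rewrite comp0l comp0r.
- by rewrite comp0l comp0r.
Qed.

Lemma mono_in_idm (A : set T) X : A zob -> mono_in xi A (idm X).
Proof. by move=> A0; apply: mono_in_iso A0 (is_iso_idm X). Qed.

Lemma epi_in_idm (A : set T) X : A zob -> epi_in xi A (idm X).
Proof.
move=> A0; apply/(epi_inP hxi); exists zob, 0, 0; split=> //.
exact: pc_split hxi _ (dist_id_zob X) erefl.
Qed.

Lemma mono_in_zob (A : set T) X :
  retract_closed_ob A -> mono_in xi A (0 : hom zob X) <-> A X.
Proof.
move=> RA; rewrite (mono_inP hxi); split=> [[Z [v [w [/xi_dist D AZ]]]]|AX].
  exact: xi_cone_unique (D hxi) (dist_id_zob X) AZ.
by exists X, (idm X), 0; split=> //; apply: pc_split hxi _ (dist_id_zob X) erefl.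
Qed.

Lemma epi_in_zob (A : set T) X :
  retract_closed_ob A -> epi_in xi A (0 : hom X zob) <-> A X.
Proof.
move=> RA; rewrite (epi_inP hxi); split=> [[Z [v [w [/xi_dist D AZ]]]]|AX].
  exact: xi_fiber_unique (D hxi) (dist_id X) AZ.
by exists X, (idm X), 0; split=> //; apply: pc_split hxi _ (dist_id X) erefl.
Qed.

(** The criterion by which [Weq] is handled: its definition only provides some factorization, and
    this one decides by any factorization into a cofibration and a trivial fibration. *)
Lemma weq_cone X Y V A (i : hom X V) a b (p : hom V Y) :
  xi (@Tri T X V A i a b) -> C A -> epi_in xi (F `&` W) p ->
  (Weq M (p ∘ i) <-> W A).
Proof.
move=> Xi CA /(epi_inP hxi) [K [k [c [Xp [FK WK]]]]]; split; last first.
  move=> WA; exists V, i, p; split=> //.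
    by apply/(mono_inP hxi); exists A, a, b.
  by apply/(epi_inP hxi); exists K, k, c.
move=> [V' [i' [p' [/(mono_inP hxi) [A' [a' [b' [Xi' [_ WA']]]]]]]]].
move=> /(epi_inP hxi) [K' [k' [c' [Xp' [_ WK']]]]] E.
exact: (thick_factor_cone hxi tW Xi' Xp' Xi Xp (esym E)).
Qed.

(** Factor [g = q ∘ j], [f = p ∘ i] and [j ∘ p = q' ∘ j'], so that [g ∘ f] is [q ∘ q'] after
    [j' ∘ i]. The cones of [i], [j' ∘ i] and [j'] form a triangle in [xi], and the cone of [j'] may
    replace that of [j]. *)
Lemma weq_2of3 : two_out_of_three (@Weq _ M).
Proof.
move=> X Y Z f g.
have [V [j [q [/(mono_inP hxi) [A [a [b [Xj CA]]]] Eq Eg]]]] :=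
  cotorsion_factor hxi g cotC cplC.
have [U [i [p [/(mono_inP hxi) [A' [a' [b' [Xi CA']]]] Ep Ef]]]] :=
  cotorsion_factor hxi f cotC cplC.
have [S [j' [q' [/(mono_inP hxi) [A2 [a2 [b2 [Xj' CA2]]]] Eq' E]]]] :=
  cotorsion_factor hxi (j ∘ p) cotC cplC.
have [D [d [e De]]] := dist_ex (j' ∘ i).
have [Xji [? [? [? XD]]]] := xi_mono_comp hxi Xi Xj' De.
have CD : C D := cotorsion_extl hxi cotC XD CA' CA2.
have Eqq : epi_in xi (F `&` W) (q ∘ q').
  exact: epi_in_comp (cotorsion_extr hxi cotC) Eq' Eq.
have Egf : g ∘ f = (q ∘ q') ∘ (j' ∘ i).
  by rewrite Eg Ef !compA; congr (_ ∘ _); rewrite -!compA E.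
have wg : Weq M g <-> W A by rewrite Eg; apply: weq_cone Xj CA Eq.
have wf : Weq M f <-> W A' by rewrite Ef; apply: weq_cone Xi CA' Ep.
have wgf : Weq M (g ∘ f) <-> W D by rewrite Egf; apply: weq_cone Xji CD Eqq.
move: Ep Eq' => /(epi_inP hxi) [K [k [c [Xp [_ WK]]]]].
move=> /(epi_inP hxi) [K' [k' [c' [Xq' [_ WK']]]]].
have wA := thick_square_cone hxi tW Xp Xq' Xj Xj' E WK WK'; split.
- by move=> /wf WA' /wg/wA WA2; apply/wgf; apply: (thick_mid tW XD).
- by move=> /wf WA' /wgf WD; apply/wg/wA; apply: (thick_cone tW XD).
- by move=> /wg/wA WA2 /wgf WD; apply/wf; apply: (thick_fiber tW XD).
Qed.

Lemma tcofibP X Y (i : hom X Y) :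
  CoFib M i /\ Weq M i <-> mono_in xi (C `&` W) i.
Proof.
have Eid := epi_in_idm Y (cotorsion_zobr cotC).
split=> [[/(mono_inP hxi) [A [a [b [Xi CA]]]] wi]|Mi].
  apply/(mono_inP hxi); exists A, a, b; split=> //; split=> //.
  by apply/(weq_cone Xi CA Eid); rewrite comp_idl.
split; last by exists Y, i, (idm Y); rewrite comp_idl.
move: Mi => /(mono_inP hxi) [A [a [b [Xi [CA _]]]]].
by apply/(mono_inP hxi); exists A, a, b.
Qed.

(** Writing [p] as [q ∘ i] with [i] a trivial cofibration and [q] a trivial fibration, the kernels
    of [p] and [q] and the cone of [i] form a triangle in [xi]. *)
Lemma tfibP X Y (p : hom X Y) :
  Fib M p /\ Weq M p <-> epi_in xi (F `&` W) p.
Proof.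
split=> [[/(epi_inP hxi) [K [k [c [Xp FK]]]]]|Ep].
  move=> [V [i [q [/(mono_inP hxi) [A [a [b [Xi [_ WA]]]]]]]]].
  move=> /(epi_inP hxi) [L [l [d [Xq [FL WL]]]]] E; rewrite E in Xp.
  have [? [? [? S]]] := xi_ker_cone hxi Xi Xq Xp.
  rewrite E; apply/(epi_inP hxi); exists K, k, c; split=> //; split=> //.
  exact: (thick_fiber tW S).
split; last first.
  exists X, (idm X), p; rewrite comp_idr; split=> //.
  exact: mono_in_idm (cotorsion_zobl cotF).
move: Ep => /(epi_inP hxi) [K [k [c [Xp [FK _]]]]].
by apply/(epi_inP hxi); exists K, k, c.
Qed.

Lemma weq_iso X Y (f : hom X Y) : is_iso f -> Weq M f.
Proof.
by move=> fi; case/(tcofibP f): (mono_in_iso (cotorsion_zobl cotF) fi).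
Qed.

Lemma mono_in_bip X Y Z (k : hom X Y) :
  mono_in xi (C `&` W) k -> mono_in xi (C `&` W) (bip_map k (idm Z)).
Proof.
move=> /(mono_inP hxi) [A [a [b [Xk AA]]]]; apply/(mono_inP hxi).
have XZ : xi (Tri (idm Z) (0 : hom Z zob) (0 : hom zob (Z⟦1⟧))).
  exact: pc_split hxi _ (dist_id Z) erefl.
have := pc_sum hxi Xk XZ; rewrite /triangle_sum /=.
set v := bip_map a 0; set w := (w in Tri _ _ w) => Xs.
exists (bip A zob), v, w; split=> //.
have e : injl A zob ∘ prl A zob = idm (bip A zob).
  by rewrite -[RHS]injl_prlD [prr A zob]hom_to_zob comp0r addr0.
exact: (cotorsion_retractl hxi cotF e AA).
Qed.

(* For a fibration [q], lifting against the trivial cofibration part of [g]   *)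
(* exhibits [q] as a retract of its trivial fibration part.                    *)
Lemma fib_weq_retract X Y X' Y' (q : hom X Y) (g : hom X' Y') :
  retract q g -> Fib M q -> Weq M g -> epi_in xi (F `&` W) q.
Proof.
move=> [i [r [j [s [ri sj gi qr]]]]] Fq [V [m [p [Mm Ep Eg]]]].
move: Mm Fq => /(mono_inP hxi) [A [a [b [Xm AA]]]].
move=> /(epi_inP hxi) [K [k [c [Xq FK]]]].
have [|e [em qe]] := lifts_Ext hxi Xm Xq (cotorsion_Ext cotF AA FK) (f := r) (g := s ∘ p).
  by rewrite qr Eg compA.
apply: (epi_in_retract hxi (cotorsion_retractr hxi cotC) _ Ep).
exists (m ∘ i), e, j, s; split=> //.
- by rewrite compA em.
- by rewrite compA -Eg.
Qed.

(** With [f = q ∘ k], [k] a trivial cofibration and [q] a fibration, it remains to treat [q]. As [i]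
    is split, its target is X + N, so the pushout of [k] along [i] exists: it is V + N, with [k]
    summed with the identity of [N]. The induced map [q'] is a weak equivalence having [q] as a
    retract. *)
Lemma weq_retract : retract_closed (@Weq _ M).
Proof.
move=> X Y X' Y' f g [i [r [j [s [ri sj gi fr]]]]] Wg.
have [V [k [q [Mk Eq Ef]]]] := cotorsion_factor hxi f cotF cplF.
exists V, k, q; split=> //.
have [N [v /(xi_dist hxi) D]] := xi_split_mono hxi ri.
have [h ih [hi _]] := dist_third_unique (dist_bip X N) D.
(* Induced from the pushout by [j ∘ q] on [V] and [g] on [N]; [e] is likewise induced by the
   identity of [V] and by [k ∘ r]. *)
pose q' : hom (bip V N) Y' := j ∘ q ∘ prl V N + (g ∘ h ∘ injr X N) ∘ prr V N.
pose e : hom (bip V N) V := idm V ∘ prl V N + (k ∘ r ∘ h ∘ injr X N) ∘ prr V N.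
have Wq' : Weq M q'.
  have Eq' : q' ∘ bip_map k (idm N) = g ∘ h.
    apply: bip_hom_ext; rewrite -compA /bip_map ?copair_injl ?copair_injr.
      by rewrite compA copair_injl -!compA hi gi Ef.
    by rewrite comp_idr copair_injr.
  have [_ + _] := weq_2of3 (bip_map k (idm N)) q'; apply.
    by have /tcofibP [] := mono_in_bip N Mk.
  have [+ _ _] := weq_2of3 h g; rewrite Eq'; apply=> //; exact: weq_iso.
apply: (fib_weq_retract (g := q')) => //; exists (injl V N), e, j, s; split=> //.
- exact: copair_injl.
- exact: copair_injl.
apply: bip_hom_ext; rewrite -!compA ?copair_injl ?copair_injr.
  by rewrite comp_idr compA sj comp_idl.
by rewrite !compA -Ef fr.
Qed.

Lemma cofibrant_model_of_hovey : cofibrant M = C.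
Proof.
apply/seteqP; split=> X /(mono_in_zob X (cotorsion_retractl hxi cotC)) //.
Qed.

Lemma fibrant_model_of_hovey : fibrant M = F.
Proof.
by apply/seteqP; split=> X /(epi_in_zob X (cotorsion_retractr hxi cotF)).
Qed.

Lemma trivial_model_of_hovey : trivial_ob M = W.
Proof.
apply/seteqP; split=> X.
  move=> [V [i [p [Mi Ep E]]]].
  have i0 : i = 0 by apply: hom_from_zob.
  rewrite i0 in Mi; have [_ WV] := (mono_in_zob V (cotorsion_retractl hxi cotF)).1 Mi.
  move: Ep => /(epi_inP hxi) [K [k [c [Xp [_ WK]]]]].
  exact: (thick_cone tW Xp).
move=> WX; have [V [i [p [Mi Ep E]]]] := cotorsion_factor hxi (0 : hom zob X) cotC cplC.
suff: Weq M (p ∘ i) by rewrite -E.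
clear E.
have i0 : i = 0 by apply: hom_from_zob.
rewrite i0 in Mi *; have CV := (mono_in_zob V (cotorsion_retractl hxi cotC)).1 Mi.
have XV : xi (Tri (0 : hom zob V) (idm V) 0).
  exact: pc_split hxi _ (dist_id_zob V) erefl.
apply/(weq_cone XV CV Ep).
move: Ep => /(epi_inP hxi) [K [k [c [Xp [_ WK]]]]].
exact: (thick_mid tW Xp).
Qed.

Lemma hovey_of_model_of_hovey : hovey_of_model M = H.
Proof.
rewrite /hovey_of_model cofibrant_model_of_hovey fibrant_model_of_hovey.
by rewrite trivial_model_of_hovey; case: H.
Qed.

Lemma model_structure_of_hovey : model_structure M.
Proof.
split.
- exact: weq_2of3.
- exact: mono_in_retract hxi _ (cotorsion_retractl hxi cotC).
- exact: epi_in_retract hxi _ (cotorsion_retractr hxi cotF).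
- exact: weq_retract.
- move=> A B X Y i p Ci Fp [Wi|Wp].
    have /(mono_inP hxi) [A' [a [b [Xi AA]]]] := (tcofibP i).1 (conj Ci Wi).
    have /(epi_inP hxi) [K [k [c [Xp FK]]]] := Fp.
    exact: (lifts_Ext hxi Xi Xp (cotorsion_Ext cotF AA FK)).
  have /(mono_inP hxi) [A' [a [b [Xi AA]]]] := Ci.
  have /(epi_inP hxi) [K [k [c [Xp FK]]]] := (tfibP p).1 (conj Fp Wp).
  exact: (lifts_Ext hxi Xi Xp (cotorsion_Ext cotC AA FK)).
- move=> X Y f; split.
    have [V [i [p [/tcofibP [Ci Wi] Ep Ef]]]] := cotorsion_factor hxi f cotF cplF.
    by exists V, i, p.
  have [V [i [p [Ci /tfibP [Fp Wp] Ef]]]] := cotorsion_factor hxi f cotC cplC.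
  by exists V, i, p.
Qed.

Lemma xi_triangulated_model_of_hovey : xi_triangulated_model xi M.
Proof.
split; rewrite ?cofibrant_model_of_hovey ?fibrant_model_of_hovey
  ?trivial_model_of_hovey //.
- exact: model_structure_of_hovey.
- exact: tcofibP.
- exact: tfibP.
Qed.

End ModelOfHovey.

(** * From model structures to Hovey triples *)

Section HoveyOfModel.
Variables (T : triangulated) (xi : set (triangle T)) (hxi : proper_class xi).
Variables (M : mor_triple T) (hM : xi_triangulated_model xi M).
Implicit Types X Y Z K L V : T.
Notation C := (cofibrant M).
Notation F := (fibrant M).
Notation W := (trivial_ob M).

Let ms : model_structure M. Proof. by case: hM. Qed.

Lemma cofibP X Y (i : hom X Y) :
  CoFib M i <-> exists Z v w, xi (@Tri T X Y Z i v w) /\ C Z.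
Proof. by rewrite (xtm_cofib hM) (mono_inP hxi). Qed.

Lemma trivial_cofibP X Y (i : hom X Y) :
  CoFib M i /\ Weq M i <-> exists Z v w, xi (@Tri T X Y Z i v w) /\ (C `&` W) Z.
Proof. by rewrite (xtm_tcofib hM) (mono_inP hxi). Qed.

Lemma fibP X Y (p : hom X Y) :
  Fib M p <-> exists K k c, xi (@Tri T K X Y k p c) /\ F K.
Proof. by rewrite (xtm_fib hM) (epi_inP hxi). Qed.

Lemma trivial_fibP X Y (p : hom X Y) :
  Fib M p /\ Weq M p <-> exists K k c, xi (@Tri T K X Y k p c) /\ (F `&` W) K.
Proof. by rewrite (xtm_tfib hM) (epi_inP hxi). Qed.

Lemma cofib_factor X Y (f : hom X Y) :
  exists Z (i : hom X Z) (p : hom Z Y),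
    [/\ CoFib M i, Fib M p /\ Weq M p & f = p ∘ i].
Proof. by have [_ [Z [i [p [Ci Fp Wp E]]]]] := ms_factor ms f; exists Z, i, p. Qed.

Lemma fib_factor X Y (f : hom X Y) :
  exists Z (i : hom X Z) (p : hom Z Y),
    [/\ CoFib M i /\ Weq M i, Fib M p & f = p ∘ i].
Proof. by have [[Z [i [p [Ci Fp Wp E]]]] _] := ms_factor ms f; exists Z, i, p. Qed.

Lemma retract_from_zob X Y (s : hom X Y) r : r ∘ s = idm X ->
  retract (0 : hom zob X) (0 : hom zob Y).
Proof.
move=> rs; exists (idm zob), (idm zob), s, r.
by rewrite comp_idl !comp0r !comp0l.
Qed.

Lemma retract_to_zob X Y (s : hom X Y) r : r ∘ s = idm X ->
  retract (0 : hom X zob) (0 : hom Y zob).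
Proof.
move=> rs; exists s, r, (idm zob), (idm zob).
by rewrite comp_idl !comp0r !comp0l.
Qed.

Lemma cofibrant_retract : retract_closed_ob C.
Proof. by move=> X Y s r /retract_from_zob; apply: (ms_cofib_retract ms). Qed.

Lemma fibrant_retract : retract_closed_ob F.
Proof. by move=> X Y s r /retract_to_zob; apply: (ms_fib_retract ms). Qed.

Lemma trivial_retract : retract_closed_ob W.
Proof. by move=> X Y s r /retract_from_zob; apply: (ms_weq_retract ms). Qed.

Lemma weq_comp X Y Z (f : hom X Y) (g : hom Y Z) :
  Weq M f -> Weq M g -> Weq M (g ∘ f).
Proof. by have [] := ms_2of3 ms f g. Qed.

Lemma weq_cancell X Y Z (f : hom X Y) (g : hom Y Z) :
  Weq M f -> Weq M (g ∘ f) -> Weq M g.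
Proof. by have [] := ms_2of3 ms f g. Qed.

Lemma weq_cancelr X Y Z (f : hom X Y) (g : hom Y Z) :
  Weq M g -> Weq M (g ∘ f) -> Weq M f.
Proof. by have [] := ms_2of3 ms f g. Qed.

(** Factoring the identity of [zob] makes it a retract of a cofibrant object. *)
Lemma cofibrant_zob : C zob.
Proof.
have [Z [i [p [Ci _ E]]]] := cofib_factor (idm zob).
by apply: (cofibrant_retract (esym E)); rewrite [i]hom_from_zob in Ci.
Qed.

Lemma trivial_zob : W zob.
Proof.
have [Z [i [p [[_ Wi] _ E]]]] := fib_factor (idm zob).
by apply: (trivial_retract (esym E)); rewrite [i]hom_from_zob in Wi.
Qed.

Lemma fibrant_zob : F zob.
Proof.
have [Z [i [p [_ Fp E]]]] := fib_factor (idm zob).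
by apply: (fibrant_retract (esym E)); rewrite [p]hom_to_zob in Fp.
Qed.

Lemma trivial_cofib_iso X Y (f : hom X Y) : is_iso f -> CoFib M f /\ Weq M f.
Proof.
move=> fi; apply/trivial_cofibP/(mono_inP hxi)/mono_in_iso => //.
by split; [exact: cofibrant_zob | exact: trivial_zob].
Qed.

Lemma trivial_to_zob X : W X <-> Weq M (0 : hom X zob).
Proof.
have W0 : Weq M ((0 : hom X zob) ∘ (0 : hom zob X)).
  by rewrite comp0r -idm_zob; have [] := trivial_cofib_iso (is_iso_idm zob).
by split=> WX; [apply: weq_cancell WX W0 | apply: weq_cancelr WX W0].
Qed.

Lemma trivial_weq X Y (f : hom X Y) : Weq M f -> (W X <-> W Y).
Proof.
move=> Wf; have E : f ∘ 0 = (0 : hom zob Y) by rewrite comp0r.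
split=> WX; first by rewrite /trivial_ob /= -E; apply: weq_comp.
by apply: (weq_cancelr Wf); rewrite E.
Qed.

(** Lifting the identity of [X] through the trivial fibration [v] gives a section, so the triangle
    splits. *)
Lemma Ext_cofib_tfib X K : C X -> F K /\ W K -> Ext_zero xi X K.
Proof.
move=> CX FWK E u v w Xt; have [Fv Wv] : Fib M v /\ Weq M v.
  by apply/trivial_fibP; exists K, u, w.
have [|s [_ vs]] := ms_lift ms CX Fv (or_intror Wv) (f := 0) (g := idm X).
  by rewrite !comp0r.
exact: dist_sect_w0 (xi_dist hxi Xt) vs.
Qed.

Lemma Ext_tcofib_fib X K : C X /\ W X -> F K -> Ext_zero xi X K.
Proof.
move=> [CX WX] FK E u v w Xt; have Fv : Fib M v by apply/fibP; exists K, u, w.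
have [|s [_ vs]] := ms_lift ms CX Fv (or_introl WX) (f := 0) (g := idm X).
  by rewrite !comp0r.
exact: dist_sect_w0 (xi_dist hxi Xt) vs.
Qed.

Lemma cofibrant_approx Z :
  exists X K (k : hom K X) (p : hom X Z) c, [/\ xi (Tri k p c), C X & (F `&` W) K].
Proof.
have [X [i [p [Ci /trivial_fibP [K [k [c [Xp FK]]]] E]]]] := cofib_factor (0 : hom zob Z).
by exists X, K, k, p, c; split=> //; rewrite [i]hom_from_zob in Ci.
Qed.

Lemma tcofibrant_approx Z :
  exists X K (k : hom K X) (p : hom X Z) c, [/\ xi (Tri k p c), (C `&` W) X & F K].
Proof.
have [X [i [p [[Ci Wi] /fibP [K [k [c [Xp FK]]]] E]]]] := fib_factor (0 : hom zob Z).
by rewrite [i]hom_from_zob in Ci Wi; exists X, K, k, p, c; split.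
Qed.

Lemma tfibrant_approx Z :
  exists Y A (i : hom Z Y) (a : hom Y A) b, [/\ xi (Tri i a b), C A & (F `&` W) Y].
Proof.
have [Y [i [p [/cofibP [A [a [b [Xi CA]]]] [Fp Wp] E]]]] := cofib_factor (0 : hom Z zob).
rewrite [p]hom_to_zob in Fp Wp; exists Y, A, i, a, b; split=> //.
by split=> //; apply/trivial_to_zob.
Qed.

Lemma fibrant_approx Z :
  exists Y A (i : hom Z Y) (a : hom Y A) b, [/\ xi (Tri i a b), (C `&` W) A & F Y].
Proof.
have [Y [i [p [/trivial_cofibP [A [a [b [Xi CA]]]] Fp E]]]] := fib_factor (0 : hom Z zob).
by rewrite [p]hom_to_zob in Fp; exists Y, A, i, a, b; split.
Qed.

(** An object orthogonal to one class splits its own approximation triangle, hence is a retract of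
    an object of the other class. *)
Lemma cotorsion_of_approx (A B : set T) :
  retract_closed_ob A -> retract_closed_ob B ->
  (forall X Y, A X -> B Y -> Ext_zero xi X Y) -> complete_pair xi A B ->
  cotorsion_pair xi A B.
Proof.
move=> RA RB EAB cAB; split; apply/seteqP; split=> Z /=.
- by move=> BZ X AX; apply: EAB.
- move=> EZ; have [_ [X [Y [u [v [w [Xt AX BY]]]]]]] := cAB Z.
  have w0 := EZ X AX _ _ _ _ Xt; rewrite {}w0 in Xt.
  by have [r ru] := dist_split_retr (xi_dist hxi Xt); apply: RB ru BY.
- by move=> AZ Y BY; apply: EAB.
- move=> EZ; have [[X [Y [u [v [w [Xt AX BY]]]]]] _] := cAB Z.
  have w0 := EZ Y BY _ _ _ _ Xt; rewrite {}w0 in Xt.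
  by have [s vs] := dist_split_sect (xi_dist hxi Xt); apply: RA vs AX.
Qed.

Lemma complete_cofibrant : complete_pair xi C (F `&` W).
Proof.
move=> Z; split.
  by have [X [K [k [p [c [Xp CX FK]]]]]] := cofibrant_approx Z; exists X, K, k, p, c.
by have [Y [A [i [a [b [Xi CA FY]]]]]] := tfibrant_approx Z; exists A, Y, i, a, b.
Qed.

Lemma complete_fibrant : complete_pair xi (C `&` W) F.
Proof.
move=> Z; split.
  by have [X [K [k [p [c [Xp CX FK]]]]]] := tcofibrant_approx Z; exists X, K, k, p, c.
by have [Y [A [i [a [b [Xi CA FY]]]]]] := fibrant_approx Z; exists A, Y, i, a, b.
Qed.

Lemma retract_closed_obI (A B : set T) :
  retract_closed_ob A -> retract_closed_ob B -> retract_closed_ob (A `&` B).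
Proof. by move=> RA RB X Y s r rs [AX BX]; split; [apply: RA rs AX | apply: RB rs BX]. Qed.

Lemma cotorsion_cofibrant : cotorsion_pair xi C (F `&` W).
Proof.
apply: cotorsion_of_approx complete_cofibrant; first exact: cofibrant_retract.
  exact: retract_closed_obI fibrant_retract trivial_retract.
exact: Ext_cofib_tfib.
Qed.

Lemma cotorsion_fibrant : cotorsion_pair xi (C `&` W) F.
Proof.
apply: cotorsion_of_approx complete_fibrant; last exact: Ext_tcofib_fib.
  exact: retract_closed_obI cofibrant_retract trivial_retract.
exact: fibrant_retract.
Qed.

(* Base change along a cofibrant approximation of [Z] with trivially fibrant   *)
(* kernel replaces [u] by a cofibration without changing its homotopy type.    *)
Lemma weq_xi_mono X Y Z (u : hom X Y) v w :
  xi (@Tri T X Y Z u v w) -> (Weq M u <-> W Z).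
Proof.
move=> Xt; have [V [K [k [p [c [Xp CV FK]]]]]] := cofibrant_approx Z.
have [P [k' [p' [u' [n [Dp' Dn _ _ E]]]]]] :=
  dist_pullback (xi_dist hxi Xp) (xi_dist hxi Xt).
have Xp' := phantom_xi hxi (phantom_base hxi v (xi_phantom Xp)) Dp'.
have Xn := phantom_xi hxi (phantom_base hxi p (xi_phantom Xt)) Dn.
have [_ Wp] : Fib M p /\ Weq M p by apply/trivial_fibP; exists K, k, c.
have [_ Wp'] : Fib M p' /\ Weq M p' by apply/trivial_fibP; exists K, k', (c ∘ v).
have Cu' : CoFib M u' by apply/cofibP; exists V, n, (w ∘ p).
rewrite -E -(trivial_weq Wp); split=> [Wu|WV].
  have /trivial_cofibP [V' [v' [w' [Xu' [_ WV']]]]] := conj Cu' (weq_cancelr Wp' Wu).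
  exact: (xi_cone_unique trivial_retract (xi_dist hxi Xu') (xi_dist hxi Xn)).
apply: weq_comp Wp'; have [] // : CoFib M u' /\ Weq M u'.
by apply/trivial_cofibP; exists V, n, (w ∘ p).
Qed.

Lemma thick_trivial : thick xi W.
Proof.
split.
- by move=> X Y f /trivial_cofib_iso [_ /trivial_weq ->].
- move=> X Y WXY; split; first exact: trivial_retract (prl_injl X Y) WXY.
  exact: trivial_retract (prr_injr X Y) WXY.
move=> [X Y Z u v w] /= Xt; have WuZ := weq_xi_mono Xt; split.
- move=> WX WY; apply/WuZ; apply: (weq_cancell WX).
  by rewrite comp0r; exact: WY.
- by move=> WX /WuZ/trivial_weq <-.
- by move=> WY /WuZ/trivial_weq ->.
Qed.

Lemma hovey_triple_of_model : hovey_triple xi (hovey_of_model M).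
Proof.
split; first exact: thick_trivial.
  by split; [exact: cotorsion_cofibrant | exact: complete_cofibrant].
by split; [exact: cotorsion_fibrant | exact: complete_fibrant].
Qed.

Lemma model_of_hovey_of_model : model_of_hovey xi (hovey_of_model M) = M.
Proof.
have ext (S S' : mor_class T) : (forall X Y (f : hom X Y), S _ _ f <-> S' _ _ f) -> S = S'.
  move=> E; apply: functional_extensionality_dep => X.
  apply: functional_extensionality_dep => Y.
  by apply/seteqP; split=> f /E.
have Ec : mono_in xi C = @CoFib _ M by apply: ext => X Y f; rewrite (xtm_cofib hM).
have Ef : epi_in xi F = @Fib _ M by apply: ext => X Y f; rewrite (xtm_fib hM).
have Ew : @Weq _ (model_of_hovey xi (hovey_of_model M)) = @Weq _ M.
  apply: ext => X Y f; split=> [[Z [i [p [Mi Ep ->]]]]|Wf].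
    by apply: weq_comp; [move/(xtm_tcofib hM): Mi | move/(xtm_tfib hM): Ep] => -[].
  have [Z [i [p [[Ci Wi] Fp E]]]] := fib_factor f; rewrite E in Wf *.
  exists Z, i, p; split=> //; first exact/(xtm_tcofib hM).
  by apply/(xtm_tfib hM); split=> //; apply: weq_cancell Wi Wf.
have eta (N N' : mor_triple T) : @CoFib _ N = @CoFib _ N' -> @Fib _ N = @Fib _ N' ->
    @Weq _ N = @Weq _ N' -> N = N'.
  by case: N N' => [c f w] [c' f' w'] /= -> -> ->.
exact: eta.
Qed.

End HoveyOfModel.

(** * The homotopy category *)

Section LocalizationNat.
Variables (C : category) (S : mor_class C) (D : category).
Variables (G G' : functor (localization S) D).
Variable eta : forall X : localization S, hom (G X) (G' X).

(** Induction on words; naturality at a formal inverse follows from naturality at the map it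
    inverts. *)
Lemma loc_natural :
  (forall (X Y : C) (f : hom X Y),
     eta Y ∘ fmap G (fmap (loc_functor S) f) = fmap G' (fmap (loc_functor S) f) ∘ eta X) ->
  forall (X Y : localization S) (a : hom X Y), eta Y ∘ fmap G a = fmap G' a ∘ eta X.
Proof.
move=> nat X Y a; rewrite -[a]qreprK; elim: (qrepr a) => [|Z V f b IH|Z V s Ws b IH].
- by rewrite (fmap_id G X) (fmap_id G' X) comp_idl comp_idr.
- rewrite (_ : qclass _ _ = (fmap (loc_functor S) f : @hom (localization S) Z V)
    ∘ (zz_class b)); last by rewrite [RHS]qcompE.
  by rewrite !fmap_comp compA nat -!compA; congr (_ ∘ _); exact: IH.
pose t : @hom (localization S) Z V := zz_class (zz_bwd Ws (zz_nil S Z)).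
have [st ts] : (fmap (loc_functor S) s : @hom (localization S) V Z) ∘ t = idm (Z : localization S) /\
    t ∘ (fmap (loc_functor S) s : @hom (localization S) V Z) = idm (V : localization S).
  split; rewrite [LHS]qcompE; apply/qclassP/cong_base.
    exact: zz_rel_invr.
  exact: zz_rel_invl.
rewrite (_ : qclass _ _ = t ∘ (zz_class b)); last by rewrite [RHS]qcompE.
have tnat : eta V ∘ fmap G t = fmap G' t ∘ eta Z.
  rewrite -[LHS]comp_idl -(fmap_id G' V) -ts fmap_comp -!compA (compA _ (eta V)).
  by rewrite -nat -compA -fmap_comp st fmap_id comp_idr.
by rewrite !fmap_comp compA tnat -!compA; congr (_ ∘ _); exact: IH.
Qed.

End LocalizationNat.

Lemma nat_iso_of (C D : category) (F G : functor C D)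
    (eta : forall X : C, hom (F X) (G X)) :
  (forall X, is_iso (eta X)) ->
  (forall X Y (f : hom X Y), eta Y ∘ fmap F f = fmap G f ∘ eta X) ->
  nat_iso F G.
Proof.
move=> ieta nat; exists eta (fun X => sval (cid (ieta X))) => //.
- by move=> X; case: cid => t /= [].
- by move=> X; case: cid => t /= [].
Defined.

Section Ideal.
Variables (T : additive) (N : set T).
Implicit Types X Y Z : T.

Lemma factors_through_compl X Y Z (g : hom Y Z) (f : hom X Y) :
  factors_through N f -> factors_through N (g ∘ f).
Proof. by move=> [V [a [b [NV ->]]]]; exists V, a, (g ∘ b); rewrite compA. Qed.

Lemma factors_through_compr X Y Z (g : hom Y Z) (f : hom X Y) :
  factors_through N g -> factors_through N (g ∘ f).
Proof. by move=> [V [a [b [NV ->]]]]; exists V, (a ∘ f), b; rewrite compA. Qed.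

End Ideal.

Section Homotopy.
Variables (T : triangulated) (xi : set (triangle T)) (hxi : proper_class xi).
Variables (M : mor_triple T) (hM : xi_triangulated_model xi M).
Implicit Types X Y Z K L V : T.
Notation C := (cofibrant M).
Notation F := (fibrant M).
Notation W := (trivial_ob M).
Notation N := (C `&` F `&` W).

Let cotC : cotorsion_pair xi C (F `&` W) := cotorsion_cofibrant hxi hM.
Let cotF : cotorsion_pair xi (C `&` W) F := cotorsion_fibrant hxi hM.
Let tW : thick xi W := thick_trivial hxi hM.

Lemma xi_bip X Y : xi (Tri (injl X Y) (prr X Y) 0).
Proof. exact: pc_split hxi _ (dist_bip X Y) erefl. Qed.

Lemma null_zob : N zob.
Proof.
by split; [split; [exact: cofibrant_zob hM|exact: fibrant_zob hM]|exact: trivial_zob hM].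
Qed.

Lemma null_bip X Y : N X -> N Y -> N (bip X Y).
Proof.
move=> [[CX FX] WX] [[CY FY] WY]; have Xb := xi_bip X Y; split; first split.
- exact: (cotorsion_extl hxi cotC Xb).
- exact: (cotorsion_extr hxi cotF Xb).
- exact: (thick_mid tW Xb).
Qed.

(** A fibrant approximation of [S] is cofibrant, fibrant and trivial, and [f] extends to it because
    [Y] is fibrant. *)
Lemma null_from_tcofibrant S Y (f : hom S Y) :
  (C `&` W) S -> F Y -> factors_through N f.
Proof.
move=> [CS WS] FY.
have [V [A [i [a [b [Xi [CA WA] FV]]]]]] := fibrant_approx hxi hM S.
have [g Eg] := Ext_extend hxi f Xi (cotorsion_Ext cotF (conj CA WA) FY).
exists V, i, g; split=> //; split; last exact: (thick_mid tW Xi).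
by split=> //; apply: (cotorsion_extl hxi cotC Xi).
Qed.

Lemma null_to_tfibrant X K (f : hom X K) :
  C X -> (F `&` W) K -> factors_through N f.
Proof.
move=> CX [FK WK].
have [V [L [l [p [c [Xp CV [FL WL]]]]]]] := cofibrant_approx hxi hM K.
have [g Eg] := Ext_lift hxi f Xp (cotorsion_Ext cotC CX (conj FL WL)).
exists V, g, p; split=> //; split; last exact: (thick_mid tW Xp).
by split=> //; apply: (cotorsion_extr hxi cotF Xp).
Qed.

(** Whitehead argument: in [f = p ∘ i], [p] has a section [s] and [i] a retraction [r], and each is
    a two-sided inverse up to maps through the kernel of [p] or the cone of [i], which are null. *)
Lemma weq_bifibrant X Y (f : hom X Y) :
  (C `&` F) X -> (C `&` F) Y -> Weq M f ->
  exists g, factors_through N (g ∘ f - idm X) /\ factors_through N (f ∘ g - idm Y).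
Proof.
move=> [CX FX] [CY FY] Wf.
have [V [i [p [[Ci Wi] Fp Ef]]]] := fib_factor hM f.
have Wp : Weq M p by rewrite Ef in Wf; apply: (weq_cancell hM Wi Wf).
have [A [a [b [Xi CWA]]]] := (trivial_cofibP hxi hM i).1 (conj Ci Wi).
have [K [k [c [Xp FWK]]]] := (trivial_fibP hxi hM p).1 (conj Fp Wp).
have CV : C V by apply: (cotorsion_extl hxi cotC Xi) => //; case: CWA.
have FV : F V by apply: (cotorsion_extr hxi cotF Xp) => //; case: FWK.
have [s ps] := Ext_lift hxi (idm Y) Xp (cotorsion_Ext cotC CY FWK).
have [r ri] := Ext_extend hxi (idm X) Xi (cotorsion_Ext cotF CWA FX).
have Nsp : factors_through N (s ∘ p - idm V).
  have [|l ->] := dist_lift_v (f := s ∘ p - idm V) (xi_dist hxi Xp).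
    by rewrite compBr compA -ps comp_idl comp_idr subrr.
  exact/factors_through_compl/null_to_tfibrant.
have Nir : factors_through N (i ∘ r - idm V).
  have [|y ->] := dist_ext_u (f := i ∘ r - idm V) (xi_dist hxi Xi).
    by rewrite compBl -compA -ri comp_idl comp_idr subrr.
  exact/factors_through_compr/null_from_tcofibrant.
exists (r ∘ s); rewrite {}Ef; split.
  have -> : r ∘ s ∘ (p ∘ i) - idm X = r ∘ (s ∘ p - idm V) ∘ i.
    by rewrite compBr compBl comp_idr -ri !compA.
  exact/factors_through_compr/factors_through_compl.
have -> : p ∘ i ∘ (r ∘ s) - idm Y = p ∘ (i ∘ r - idm V) ∘ s.
  by rewrite compBr compBl comp_idr -ps !compA.
exact/factors_through_compr/factors_through_compl.
Qed.

Record bifibrant_repl X := BifibrantRepl {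
  br_cof : T;
  br_ob : T;
  br_p : hom br_cof X;
  br_i : hom br_cof br_ob;
  br_cofP : C br_cof;
  br_obP : (C `&` F) br_ob;
  br_pP : Fib M br_p /\ Weq M br_p;
  br_iP : CoFib M br_i /\ Weq M br_i }.

(** Mere existence, in the form from which [repl] chooses. *)
Lemma bifibrant_repl_ex X : exists r : bifibrant_repl X, True.
Proof.
have [V [K [k [p [c [Xp CV FWK]]]]]] := cofibrant_approx hxi hM X.
have [Q [A [i [a [b [Xi CWA FQ]]]]]] := fibrant_approx hxi hM V.
have CQ : C Q by apply: (cotorsion_extl hxi cotC Xi) => //; case: CWA.
have Fp : Fib M p /\ Weq M p by apply/(trivial_fibP hxi hM); exists K, k, c.
have Ci : CoFib M i /\ Weq M i by apply/(trivial_cofibP hxi hM); exists A, a, b.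
by exists (BifibrantRepl CV (conj CQ FQ) Fp Ci).
Qed.

Definition repl X : bifibrant_repl X := sval (cid (bifibrant_repl_ex X)).

(** Replacement is a zigzag X <- cofibrant -> bifibrant, so a lift of [f] passes through a map [f']
    of the cofibrant stages. *)
Definition repl_rel X Y (f : hom X Y) (h : hom (br_ob (repl X)) (br_ob (repl Y))) :=
  exists f' : hom (br_cof (repl X)) (br_cof (repl Y)),
    br_p (repl Y) ∘ f' = f ∘ br_p (repl X) /\
    h ∘ br_i (repl X) = br_i (repl Y) ∘ f'.

Lemma repl_extend X Y (f : hom (br_cof (repl X)) Y) :
  F Y -> exists g, f = g ∘ br_i (repl X).
Proof.
move=> FY; have [A [a [b [Xi CWA]]]] := (trivial_cofibP hxi hM _).1 (br_iP (repl X)).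
exact: (Ext_extend hxi f Xi (cotorsion_Ext cotF CWA FY)).
Qed.

Lemma repl_null X Y (g : hom (br_ob (repl X)) Y) :
  F Y -> g ∘ br_i (repl X) = 0 -> factors_through N g.
Proof.
move=> FY gi; have [A [a [b [Xi CWA]]]] := (trivial_cofibP hxi hM _).1 (br_iP (repl X)).
have [y ->] := dist_ext_u (xi_dist hxi Xi) gi.
exact/factors_through_compr/null_from_tcofibrant.
Qed.

Lemma repl_rel_ex X Y (f : hom X Y) : exists h, repl_rel f h.
Proof.
have [K [k [c [Xp FWK]]]] := (trivial_fibP hxi hM _).1 (br_pP (repl Y)).
have [f' Ef'] := Ext_lift hxi (f ∘ br_p (repl X)) Xp
  (cotorsion_Ext cotC (br_cofP (repl X)) FWK).
have [_ FQ] := br_obP (repl Y).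
by have [h Eh] := repl_extend (br_i (repl Y) ∘ f') FQ; exists h, f'.
Qed.

(** Two choices of [f'] differ by a map through the trivially fibrant kernel [K]. Extended to the
    bifibrant stage it is null, and what remains of [h - h'] vanishes on the cofibrant stage. *)
Lemma repl_rel_unique X Y (f : hom X Y) h h' :
  repl_rel f h -> repl_rel f h' -> factors_through N (h - h').
Proof.
move=> [k [pk hk]] [k' [pk' hk']].
have [K [j [c [Xp FWK]]]] := (trivial_fibP hxi hM _).1 (br_pP (repl Y)).
have [|l El] := dist_lift_v (f := k - k') (xi_dist hxi Xp).
  by rewrite compBr pk pk' subrr.
have [FK WK] := FWK; have [l' El'] := repl_extend l FK.
have -> : h - h' = (h - h' - br_i (repl Y) ∘ j ∘ l') + br_i (repl Y) ∘ j ∘ l'.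
  by rewrite subrK.
apply: factors_throughD; first exact: null_bip.
  have [_ FQ] := br_obP (repl Y); apply: repl_null => //.
  by rewrite !compBl hk hk' -compBr El -!compA El' subrr.
apply/factors_through_compl/null_to_tfibrant => //.
by have [] := br_obP (repl X).
Qed.

Lemma repl_rel_id X : repl_rel (idm X) (idm _).
Proof. by exists (idm _); rewrite !comp_idl !comp_idr. Qed.

Lemma repl_rel_comp X Y Z (g : hom Y Z) (f : hom X Y) h' h :
  repl_rel g h' -> repl_rel f h -> repl_rel (g ∘ f) (h' ∘ h).
Proof.
move=> [g' [pg hg]] [f' [pf hf]]; exists (g' ∘ f'); split.
  by rewrite compA pg -compA pf compA.
by rewrite -compA hf compA hg compA.
Qed.

Lemma repl_rel_weq X Y (f : hom X Y) h : repl_rel f h -> Weq M f -> Weq M h.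
Proof.
move=> [f' [pf hf]] Wf.
have [_ WpX] := br_pP (repl X); have [_ WpY] := br_pP (repl Y).
have [_ WiX] := br_iP (repl X); have [_ WiY] := br_iP (repl Y).
apply: (weq_cancell hM WiX); rewrite hf; apply: (weq_comp hM _ WiY).
by apply: (weq_cancelr hM WpY); rewrite pf; apply: (weq_comp hM WpX Wf).
Qed.

Notation D := (additive_quotient (C `&` F) N).

Definition qcl (X Y : D) (f : @hom T (sval X) (sval Y)) : hom X Y :=
  @qclass (full_subcategory (C `&` F)) (@ideal_rel T (C `&` F) N) X Y f.

Lemma qclE (X Y : D) (f g : @hom T (sval X) (sval Y)) :
  qcl f = qcl g <-> factors_through N (f - g).
Proof.
rewrite /qcl qclassP.
exact: (@ideal_rel_congruence T (C `&` F) N null_zob null_bip X Y f g).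
Qed.

Lemma qcl_comp (X Y Z : D) (g : @hom T (sval Y) (sval Z)) (f : @hom T (sval X) (sval Y)) :
  qcl g ∘ qcl f = qcl (g ∘ f).
Proof. exact: qcompE. Qed.

Lemma qcl_surj (X Y : D) (a : hom X Y) : exists f, a = qcl f.
Proof. by exists (qrepr a); rewrite /qcl qreprK. Qed.

Lemma weq_qcl_iso (X Y : D) (f : @hom T (sval X) (sval Y)) :
  Weq M f -> is_iso (qcl f).
Proof.
move=> Wf; have [g [gf fg]] := weq_bifibrant (svalP X) (svalP Y) Wf.
by exists (qcl g); rewrite !qcl_comp; split; apply/qclE.
Qed.

Definition repl_ob X : D := exist (C `&` F) (br_ob (repl X)) (br_obP (repl X)).

Definition repl_map X Y (f : hom X Y) : @hom D (repl_ob X) (repl_ob Y) :=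
  @qcl (repl_ob X) (repl_ob Y) (sval (cid (repl_rel_ex f))).

Lemma repl_mapE X Y (f : hom X Y) h :
  repl_rel f h -> repl_map f = @qcl (repl_ob X) (repl_ob Y) h.
Proof.
move=> Rh; apply/qclE; apply: repl_rel_unique Rh.
exact: (svalP (cid (repl_rel_ex f))).
Qed.

Lemma repl_map_id X : repl_map (idm X) = idm (repl_ob X).
Proof. exact: repl_mapE (repl_rel_id X). Qed.

Lemma repl_map_comp X Y Z (g : hom Y Z) (f : hom X Y) :
  repl_map (g ∘ f) = repl_map g ∘ repl_map f.
Proof.
rewrite qcl_comp; apply: repl_mapE; apply: repl_rel_comp.
  exact: (svalP (cid (repl_rel_ex g))).
exact: (svalP (cid (repl_rel_ex f))).
Qed.

Definition repl_functor : functor T D :=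
  @Functor T D repl_ob repl_map repl_map_id repl_map_comp.

Lemma repl_functor_inverts : inverts (@Weq _ M) repl_functor.
Proof.
move=> X Y s Ws; apply: weq_qcl_iso; apply: repl_rel_weq Ws.
exact: (svalP (cid (repl_rel_ex s))).
Qed.

Notation loc := (fmap (loc_functor (@Weq _ M))).

(** X + Z serves as a cylinder: [injl X Z] and [injl X Z + injr X Z ∘ a] are both sections of the
    weak equivalence [prl X Z], so they agree in [Ho]; the map with components [g] and [b] sends
    them to [g] and [f]. *)
Lemma loc_null X Y (f g : hom X Y) : factors_through N (f - g) -> loc f = loc g.
Proof.
move=> [Z [a [b [[[CZ FZ] WZ] E]]]].
have Wp : Weq M (prl X Z).
  apply: (weq_cancell hM (f := injl X Z)).
    have [] // : CoFib M (injl X Z) /\ Weq M (injl X Z).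
    apply/(trivial_cofibP hxi hM); exists Z, (prr X Z), 0; split=> //.
    exact: xi_bip.
  by rewrite prl_injl; have [] := trivial_cofib_iso hxi hM (is_iso_idm X).
have [q [qp _]] := loc_functor_inverts Wp.
have Eu : loc (injl X Z) = loc (injl X Z + injr X Z ∘ a).
  rewrite -[LHS]comp_idl -[RHS]comp_idl -qp -!compA -!fmap_comp.
  by rewrite compDr compA prl_injl prl_injr comp0l addr0.
have -> : g = (g ∘ prl X Z + b ∘ prr X Z) ∘ injl X Z by rewrite copair_injl.
rewrite [in RHS]fmap_comp Eu -fmap_comp compDr compA copair_injl copair_injr -E.
by rewrite addrC subrK.
Qed.

Definition incl_map (X Y : D) (a : hom X Y) : @hom (Ho M) (sval X) (sval Y) :=
  loc (qrepr a : @hom T (sval X) (sval Y)).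

Lemma incl_mapE (X Y : D) (f : @hom T (sval X) (sval Y)) : incl_map (qcl f) = loc f.
Proof. by apply: loc_null; apply/qclE; rewrite /qcl qreprK. Qed.

Lemma incl_map_id (X : D) : incl_map (idm X) = idm (sval X : Ho M).
Proof. by rewrite (incl_mapE (idm (sval X))) fmap_id. Qed.

Lemma incl_map_comp (X Y Z : D) (b : hom Y Z) (a : hom X Y) :
  incl_map (b ∘ a) = incl_map b ∘ incl_map a.
Proof.
have [f ->] := qcl_surj a; have [g ->] := qcl_surj b.
by rewrite qcl_comp !incl_mapE fmap_comp.
Qed.

Definition incl_functor : functor D (Ho M) :=
  @Functor D (Ho M) (fun X : D => sval X) incl_map incl_map_id incl_map_comp.

Theorem Ho_equivalent : equivalent (Ho M) D.
Proof.
pose Q := loc_lift repl_functor_inverts.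
have QE X Y (f : hom X Y) : fmap Q (loc f) = repl_map f.
  exact: (loc_lift_class repl_functor_inverts f).
have pinv X : is_iso (loc (br_p (repl X))).
  by apply: loc_functor_inverts; have [] := br_pP (repl X).
pose pi X := sval (cid (pinv X)).
have pip X : pi X ∘ loc (br_p (repl X)) = idm _ /\ loc (br_p (repl X)) ∘ pi X = idm _.
  exact: (svalP (cid (pinv X))).
(* The unit runs along the zigzag, inverting the trivial fibration [br_p]. *)
pose eta (X : Ho M) : hom (functor_id (Ho M) X) (functor_comp incl_functor Q X) :=
  loc (br_i (repl X)) ∘ pi X.
have ieta X : is_iso (eta X).
  apply: is_iso_comp.
    by apply: loc_functor_inverts; have [] := br_iP (repl X).
  by exists (loc (br_p (repl X))); have [] := pip X.
have neta (X Y : T) (f : hom X Y) : eta Y ∘ fmap (functor_id (Ho M)) (loc f) =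
    fmap (functor_comp incl_functor Q) (loc f) ∘ eta X.
  have [h Rh] := repl_rel_ex f.
  have -> : fmap (functor_comp incl_functor Q) (loc f) = loc h.
    transitivity (incl_map (repl_map f)); first exact: congr1 (QE _ _ f).
    by rewrite (repl_mapE Rh); apply: (@incl_mapE (repl_ob X) (repl_ob Y)).
  have [f' [pf hf]] := Rh.
  have -> : fmap (functor_id (Ho M)) (loc f) = loc (br_p (repl Y)) ∘ loc f' ∘ pi X.
    by rewrite -fmap_comp pf fmap_comp -compA (pip X).2 comp_idr.
  rewrite /eta !compA -(fmap_comp (loc_functor _)) hf fmap_comp.
  rewrite -!compA; congr (_ ∘ _).
  exact: etrans (compA _ _ _) (etrans (congr1 (fun k => k ∘ _) (pip Y).1) (comp_idl _)).
(* If [X] is already bifibrant, [br_p] extends over the trivial cofibration [br_i] because [X] is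
   fibrant; the extension is a weak equivalence and gives the counit. *)
have e_ex (X : D) : exists e : @hom T (br_ob (repl (sval X))) (sval X),
    br_p (repl (sval X)) = e ∘ br_i (repl (sval X)).
  by apply: repl_extend; have [] := svalP X.
pose e (X : D) := sval (cid (e_ex X)).
have eP (X : D) : br_p (repl (sval X)) = e X ∘ br_i (repl (sval X)) := svalP (cid (e_ex X)).
pose eps (X : D) : hom (functor_comp Q incl_functor X) (functor_id D X) :=
  @qcl (repl_ob (sval X)) X (e X).
have ieps (X : D) : is_iso (eps X).
  apply: weq_qcl_iso; have [_ Wp] := br_pP (repl (sval X)).
  have [_ Wi] := br_iP (repl (sval X)).
  by apply: (weq_cancell hM Wi); rewrite -eP.
have neps (X Y : D) (a : hom X Y) :
    eps Y ∘ fmap (functor_comp Q incl_functor) a = fmap (functor_id D) a ∘ eps X.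
  have [f Ea] := qcl_surj a; have [h Rh] := repl_rel_ex f.
  have -> : fmap (functor_comp Q incl_functor) a =
      @qcl (repl_ob (sval X)) (repl_ob (sval Y)) h.
    rewrite -(repl_mapE Rh) -QE Ea; apply: (congr1 (fmap Q)); exact: incl_mapE.
  have -> : fmap (functor_id D) a = qcl f by [].
  have [f' [pf hf]] := Rh.
  rewrite [LHS]qcl_comp [RHS]qcl_comp; apply/qclE; apply: repl_null.
    by have [] := svalP Y.
  by rewrite compBl -!compA hf -eP -pf [e Y ∘ _]compA -eP subrr.
split; exists Q incl_functor.
  apply: (nat_iso_of (F := functor_id (Ho M)) (G := functor_comp incl_functor Q) ieta).
  exact: (loc_natural (G := functor_id (Ho M)) (G' := functor_comp incl_functor Q) neta).
exact: (nat_iso_of (F := functor_comp Q incl_functor) (G := functor_id D) ieps neps).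
Qed.

End Homotopy.

Theorem theorem1p8 (T : triangulated) (xi : set (triangle T))
    (hxi : proper_class xi) :
  (forall M : mor_triple T,
     xi_triangulated_model xi M -> hovey_triple xi (hovey_of_model M)) /\
  (forall H : ob_triple T,
     hovey_triple xi H -> xi_triangulated_model xi (model_of_hovey xi H)) /\
  (forall M : mor_triple T,
     xi_triangulated_model xi M -> model_of_hovey xi (hovey_of_model M) = M) /\
  (forall H : ob_triple T,
     hovey_triple xi H -> hovey_of_model (model_of_hovey xi H) = H) /\
  (forall (M : mor_triple T) (H : ob_triple T),
     xi_triangulated_model xi M -> hovey_triple xi H -> H = hovey_of_model M ->
     equivalent (Ho M)
       (additive_quotient (obC H `&` obF H) (obC H `&` obF H `&` obW H))).
Proof.
split; first by move=> M; apply: hovey_triple_of_model.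
split; first by move=> H; apply: xi_triangulated_model_of_hovey.
split; first by move=> M; apply: model_of_hovey_of_model.
split; first by move=> H; apply: hovey_of_model_of_hovey.
by move=> M H hM _ ->; apply: Ho_equivalent hM.
Qed.
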